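(* Let $1\le p<\infty$, $c\in\mathbb N$, $g$ a weight on $\mathbb Z^c$ satisfying (a)–(e), and $A\in\mathfrak S_{1,g}(\mathbb R^c,\mathfrak S_1)$. Then there exists a measurable function $n:\mathbb R^c\times\mathbb R^c\to\mathbb C$ such that for every $x\in L_p(\mathbb R^c,\mathbb C)$ and almost every $t\in\mathbb R^c$ the integral $\int_{\mathbb R^c}n(t,s)x(s)\,ds$ exists and $(Ax)(t)=\int_{\mathbb R^c}n(t,s)\,x(s)\,ds$.
   Context: Weight conditions on $g:\mathbb Z^c\to(0,\infty)$: (a) $g(0)=1$; (b) $g(m+n)\le g(m)g(n)$; (c) $g(-n)=g(n)$; (d) $g\ge1$; (e) for each $t\in\mathbb Z^c$, $\sqrt[n]{g(nt)}\to1$ as $n\to\infty$. $l_{1,g}(\mathbb Z^c,\mathbb C)$: families $\beta$ with $\sum_m g(m)|\beta_m|<\infty$. Nuclear operators $\mathfrak S_1(Y)$ on a Banach space $Y$: operators $Ay=\sum_i a_i(y)y_i$, $a_i\in Y^*$, $y_i\in Y$, $\sum\|a_i\|\|y_i\|<\infty$, with norm $\|A\|_{\mathfrak S_1}=\inf\sum\|a_i\|\|y_i\|$. $\varphi:L_p(\mathbb R^c,\mathbb C)\to l_p\bigl(\mathbb Z^c,L_p([0,1)^c,\mathbb C)\bigr)$, $\varphi(x)=\{x_m\}$, $x_m(t)=x(t+m)$ for $t\in[0,1)^c$ (an isometric isomorphism). $\mathfrak S_{1,g}(\mathbb R^c,\mathfrak S_1)$ is the set of $A\in\mathcal B(L_p(\mathbb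 R^c,\mathbb C))$ such that $T=\varphi A\varphi^{-1}$ has the form $(Tz)_k=\sum_{m}b_{km}z_{k-m}$ with $b_{km}\in\mathfrak S_1(L_p([0,1)^c,\mathbb C))$, $\|b_{km}\|_{\mathfrak S_1}\le\beta_m$ for some nonnegative $\beta\in l_{1,g}(\mathbb Z^c,\mathbb C)$. *)

(* Defs.v *)
From HB Require Import structures.
From mathcomp Require Import all_boot all_order all_algebra.
From mathcomp Require Import all_classical all_reals all_analysis.
From mathcomp Require Import complex.
Set Implicit Arguments.
Unset Strict Implicit.
Unset Printing Implicit Defensive.
Import Order.TTheory GRing.Theory Num.Theory numFieldNormedType.Exports.
Local Open Scope ring_scope.
Local Open Scope classical_set_scope.

Section Defs.
Variable R : realType.

(* R^c is c.-tuple R (with its library product = Borel sigma-algebra),  *)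
(* Z^c is 'rV[int]_c, C is R[i].                                        *)

Definition cabs (z : R[i]) : R := Normc.normc z.

Definition shiftv (c : nat) (t : c.-tuple R) (m : 'rV[int]_c) : c.-tuple R :=
  [tuple tnth t i + (m ord0 i)%:~R | i < c].

Definition cube (c : nat) : set (c.-tuple R) :=
  [set t | forall i : 'I_c, 0 <= tnth t i < 1].

(** Lebesgue integral of a nonnegative function on R^c, computed as the
    iterated one-dimensional Lebesgue integral (Tonelli). *)
Fixpoint lebint (c : nat) : (c.-tuple R -> \bar R) -> \bar R :=
  match c with
  | 0 => fun f => f [tuple]
  | c'.+1 => fun f =>
      (\int[@lebesgue_measure R]_x lebint (fun t => f [tuple of x :: t]))%E
  end.

Definition lnull (c : nat) (N : set (c.-tuple R)) : Prop :=
  exists A : set (c.-tuple R), measurable A /\ N `<=` A /\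
    lebint (fun t => (\1_A t)%:E) = 0%E.

Definition ae (c : nat) (P : c.-tuple R -> Prop) : Prop :=
  lnull [set t | ~ P t].

Definition ae_cube (c : nat) (P : c.-tuple R -> Prop) : Prop :=
  lnull (@cube c `&` [set t | ~ P t]).

Definition cmeas (c : nat) (f : c.-tuple R -> R[i]) : Prop :=
  measurable_fun setT (fun t => complex.Re (f t)) /\
  measurable_fun setT (fun t => complex.Im (f t)).

Definition rint (c : nat) (f : c.-tuple R -> R) : R :=
  fine (lebint (fun t => (Num.max (f t) 0)%:E)) -
  fine (lebint (fun t => (Num.max (- f t) 0)%:E)).

Definition cintegrable (c : nat) (f : c.-tuple R -> R[i]) : Prop :=
  cmeas f /\ (lebint (fun t => (cabs (f t))%:E) < +oo)%E.

Definition cint (c : nat) (f : c.-tuple R -> R[i]) : R[i] :=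
  Complex (rint (fun t => complex.Re (f t))) (rint (fun t => complex.Im (f t))).

Definition Lp (c : nat) (p : R) (f : c.-tuple R -> R[i]) : Prop :=
  cmeas f /\ (lebint (fun t => (cabs (f t) `^ p)%:E) < +oo)%E.

Definition lpnorm (c : nat) (p : R) (f : c.-tuple R -> R[i]) : R :=
  fine (lebint (fun t => (cabs (f t) `^ p)%:E)) `^ p^-1.

(** A in B(L_p(R^c,C)), acting on representatives *)
Definition bounded_op (c : nat) (p : R)
    (A : (c.-tuple R -> R[i]) -> (c.-tuple R -> R[i])) : Prop :=
  [/\ forall x, Lp p x -> Lp p (A x),
      forall x y, Lp p x -> Lp p y -> ae (fun t => x t = y t) ->
        ae (fun t => A x t = A y t),
      forall (a : R[i]) x y, Lp p x -> Lp p y ->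
        ae (fun t => A (fun s => a * x s + y s) t = a * A x t + A y t) &
      exists M : R, forall x, Lp p x -> lpnorm p (A x) <= M * lpnorm p x].

(* Y = L_p([0,1)^c, C): functions considered on the cube only           *)
Definition Lpc (c : nat) (p : R) (y : c.-tuple R -> R[i]) : Prop :=
  cmeas (fun t => if `[< @cube c t >] then y t else 0) /\
  (lebint (fun t => (\1_(@cube c) t * cabs (y t) `^ p)%:E) < +oo)%E.

Definition lpcnorm (c : nat) (p : R) (y : c.-tuple R -> R[i]) : R :=
  fine (lebint (fun t => (\1_(@cube c) t * cabs (y t) `^ p)%:E)) `^ p^-1.

Definition dual_elt (c : nat) (p : R) (a : (c.-tuple R -> R[i]) -> R[i]) : Prop :=
  [/\ forall y z, Lpc p y -> Lpc p z -> ae_cube (fun t => y t = z t) -> a y = a z,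
      forall (l : R[i]) y z, Lpc p y -> Lpc p z ->
        a (fun s => l * y s + z s) = l * a y + a z &
      exists M : R, forall y, Lpc p y -> cabs (a y) <= M * lpcnorm p y].

Definition dualnorm (c : nat) (p : R) (a : (c.-tuple R -> R[i]) -> R[i]) : \bar R :=
  ereal_sup [set (cabs (a y))%:E | y in [set y | Lpc p y /\ lpcnorm p y <= 1]].

Definition nuclear_rep (c : nat) (p : R)
    (b : (c.-tuple R -> R[i]) -> (c.-tuple R -> R[i]))
    (a : nat -> (c.-tuple R -> R[i]) -> R[i])
    (ys : nat -> c.-tuple R -> R[i]) : Prop :=
  [/\ forall i, dual_elt p (a i),
      forall i, Lpc p (ys i),
      (\sum_(0 <= i <oo) (dualnorm p (a i) * (lpcnorm p (ys i))%:E) < +oo)%E,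
      forall y, Lpc p y -> Lpc p (b y) &
      forall y, Lpc p y ->
        (fun N : nat => lpcnorm p (fun t => b y t - \sum_(i < N) a i y * ys i t))
          @ \oo --> 0].

Definition nuclear (c : nat) (p : R)
    (b : (c.-tuple R -> R[i]) -> (c.-tuple R -> R[i])) : Prop :=
  exists a ys, nuclear_rep p b a ys.

Definition nucnorm (c : nat) (p : R)
    (b : (c.-tuple R -> R[i]) -> (c.-tuple R -> R[i])) : \bar R :=
  ereal_inf [set s : \bar R | exists a ys, nuclear_rep p b a ys /\
    s = (\sum_(0 <= i <oo) (dualnorm p (a i) * (lpcnorm p (ys i))%:E))%E].

Definition weight (c : nat) (g : 'rV[int]_c -> R) : Prop :=
  (forall m, 0 < g m) /\
  [/\ g 0 = 1,
      forall m n, g (m + n) <= g m * g n,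
      forall n, g (- n) = g n,
      forall n, 1 <= g n &
      forall t : 'rV[int]_c,
        ((fun n : nat => g (t *+ n) `^ (n%:R)^-1) @ \oo --> (1 : R))].

(** the box {m in Z^c : |m_i| <= N}, indexed by {ffun 'I_c -> 'I_(2N+1)} *)
Definition boxpt (c N : nat) (f : {ffun 'I_c -> 'I_(N + N).+1}) : 'rV[int]_c :=
  \row_i ((f i)%:Z - N%:Z).

(** A in S_{1,g}(R^c, S_1): phi A phi^{-1} = T with
    (T z)_k = sum_m b_{km} z_{k-m}, ||b_{km}||_{S_1} <= beta_m,
    beta >= 0 in l_{1,g}.  Here (phi x)_k = (t |-> x (t + k)) on [0,1)^c;
    the series over m in Z^c is taken as the limit in Y of the partial sums
    over the boxes |m_i| <= N. *)
Definition S1g (c : nat) (p : R) (g : 'rV[int]_c -> R)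
    (A : (c.-tuple R -> R[i]) -> (c.-tuple R -> R[i])) : Prop :=
  bounded_op p A /\
  exists (b : 'rV[int]_c -> 'rV[int]_c -> (c.-tuple R -> R[i]) -> (c.-tuple R -> R[i]))
         (beta : 'rV[int]_c -> R),
  [/\ forall m, 0 <= beta m,
      (\esum_(m in setT) (g m * `|beta m|)%:E < +oo)%E,
      forall k m, nuclear p (b k m) /\ (nucnorm p (b k m) <= (beta m)%:E)%E &
      forall x, Lp p x -> forall k : 'rV[int]_c,
        (fun N : nat => lpcnorm p (fun t =>
            A x (shiftv t k) -
            \sum_(f : {ffun 'I_c -> 'I_(N + N).+1})
               b k (boxpt f) (fun s => x (shiftv s (k - boxpt f))) t))
        @ \oo --> 0].

End Defs.

(* Main.v *)
(* A bounded functional [a] on L_p([0,1)^c) is integration against a function h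
   with int |h||y| <= ||a|| ||y||: apply Radon-Nikodym to E |-> a(1_E), and test
   [a] on truncations of |y| times the conjugate phase of h.  Hence a nuclear
   operator sum_i a_i(.) y_i has the kernel n(t,s) = sum_i y_i(t) h_i(s), and
   since the L_1 norm on the unit cube is at most twice the L_p norm, Tonelli
   bounds int int |n(t,s)||y(s)| ds dt by 2 ||y|| sum_i ||a_i|| ||y_i||.

   The kernels of the b_{km} are glued over the products of unit cells: on
   (k + [0,1)^c) x (k - m + [0,1)^c) the kernel is that of b_{km}, translated.
   For fixed k, summability of beta makes s |-> nk(t,s) x(s) integrable for
   almost every t in the cell k.  For such t the partial sums over boxes are
   integrals of nk(t,.) x over growing unions of cells, so they converge to the
   full integral by dominated convergence; they also converge to A x in L_p, and
   by Fatou's lemma the two limits agree almost everywhere. *)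
Require Import Defs.
From HB Require Import structures.
From mathcomp Require Import all_boot all_order all_algebra.
From mathcomp Require Import all_classical all_reals all_analysis.
From mathcomp Require Import measurable_realfun complex lra zify.
Import Order.TTheory GRing.Theory Num.Theory numFieldNormedType.Exports.
Local Open Scope ring_scope.
Local Open Scope classical_set_scope.

Set Implicit Arguments.
Unset Strict Implicit.
Unset Printing Implicit Defensive.

(** * Lebesgue measure on tuples *)

(** Two obstacles shape the proof. First, Radon-Nikodym gives only an integrable density h, while y
    in L_p may be unbounded, so h y is not known to be integrable. The integral formula is therefore
    proved for bounded y, used there to estimate the integral of |h||y|, and only then extended to
    all y; this treats p = 1 and p > 1 together. Second, the kernel must be fixed before x, whereas
    the exceptional null sets depend on x. The kernels are thus chosen as jointly measurable
    functions defined everywhere, and x enters only through integral estimates. Since the nuclear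
    norm is an infimum, each b_{km} is represented at a cost below beta_m plus an error whose sum
    over m is at most 1; g >= 1 makes the beta_m themselves summable. *)

Lemma product_sigma_finite (d1 d2 : measure_display) (T1 : measurableType d1)
    (T2 : measurableType d2) (R : realType)
    (m1 : {sigma_finite_measure set T1 -> \bar R})
    (m2 : {sigma_finite_measure set T2 -> \bar R}) :
  sigma_finite setT (m1 \x m2)%E.
Proof.
have /sigma_finiteP[F [TF ndF Foo]] := sigma_finiteT m1.
have /sigma_finiteP[G [TG ndG Goo]] := sigma_finiteT m2.
exists (fun n => F n `*` G n).
  rewrite -setXTT TF TG; apply/seteqP; split=> -[x y].
    move=> [/= [n _ Fnx] [k _ Gky]]; exists (maxn n k) => //; split.
    - by move: x Fnx; exact/subsetPset/ndF/leq_maxl.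
    - by move: y Gky; exact/subsetPset/ndG/leq_maxr.
  by move=> [n _ []/= ? ?]; split; exists n.
move=> k; have [? ?] := Foo k; have [? ?] := Goo k.
split; first exact: measurableX.
by rewrite product_measure1E// lte_mul_pinfty// ge0_fin_numE.
Qed.

Section cons_measure.
Variables (R : realType) (c : nat).
Variable m : {sigma_finite_measure set (c.-tuple R) -> \bar R}.

Definition consp (x : measurableTypeR R * c.-tuple R) : c.+1.-tuple R :=
  [tuple of x.1 :: x.2].

Lemma measurable_consp : measurable_fun setT consp.
Proof. exact: (measurable_cons measurable_fst measurable_snd). Qed.

Definition unconsp (t : c.+1.-tuple R) : measurableTypeR R * c.-tuple R :=
  (thead t, [tuple of behead t]).

Lemma measurable_unconsp : measurable_fun setT unconsp.
Proof.
apply: measurable_fun_pair; first exact: measurable_tnth.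
exact: measurable_behead.
Qed.

Lemma conspK : cancel consp unconsp.
Proof.
by move=> [x t]; rewrite /consp /unconsp /= theadE; congr pair; apply/val_inj.
Qed.

Definition cons_measure : set (c.+1.-tuple R) -> \bar R :=
  pushforward (@lebesgue_measure R \x m)%E consp.

Let cons_measure0 : cons_measure set0 = 0%E.
Proof. by rewrite /cons_measure /pushforward preimage_set0 measure0. Qed.

Let cons_measure_ge0 A : (0 <= cons_measure A)%E.
Proof. by rewrite /cons_measure /pushforward measure_ge0. Qed.

Let mpre (A : set (c.+1.-tuple R)) : measurable A -> measurable (consp @^-1` A).
Proof. by move=> mA; rewrite -[X in measurable X]setTI; exact: measurable_consp. Qed.

Let cons_measure_sigma_additive : semi_sigma_additive cons_measure.
Proof.
move=> F mF tF mUF; rewrite /cons_measure /pushforward preimage_bigcup.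
apply: measure_semi_sigma_additive.
- by move=> n; exact: mpre.
- apply/trivIsetP => /= i j _ _ ij; rewrite -preimage_setI.
  by move/trivIsetP : tF => /(_ _ _ _ _ ij) ->//; rewrite preimage_set0.
- by rewrite -preimage_bigcup; exact: mpre.
Qed.

HB.instance Definition _ := isMeasure.Build _ _ _ cons_measure
  cons_measure0 cons_measure_ge0 cons_measure_sigma_additive.

Let cons_measure_sigma_finite : sigma_finite setT cons_measure.
Proof.
have [F UF mF] : sigma_finite setT (@lebesgue_measure R \x m)%E by exact: product_sigma_finite.
exists (fun n => unconsp @^-1` (F n)).
  by rewrite -preimage_bigcup -UF preimage_setT.
move=> n; have [mFn Fny] := mF n; split.
  by rewrite -[X in measurable X]setTI; exact: measurable_unconsp.
rewrite /cons_measure /pushforward -comp_preimage.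
by rewrite (_ : unconsp \o consp = id)//; apply/funext => x; exact: conspK.
Qed.

HB.instance Definition _ := Measure_isSigmaFinite.Build _ _ _ cons_measure
  cons_measure_sigma_finite.

Lemma integral_cons_measure (f : c.+1.-tuple R -> \bar R) :
  measurable_fun setT f -> (forall t, 0 <= f t)%E ->
  (\int[cons_measure]_t f t =
   \int[@lebesgue_measure R]_x \int[m]_t f [tuple of x :: t])%E.
Proof.
move=> mf f0; rewrite ge0_integral_pushforward//; last exact: measurable_consp.
rewrite preimage_setT fubini_tonelli1//; last by move=> x; exact: f0.
by apply: measurableT_comp => //; exact: measurable_consp.
Qed.

End cons_measure.

Section lebn.
Variable R : realType.

(** [lebint] is an iterated integral; a measure behind it gives access to Tonelli, Fatou, dominated
    convergence and Radon-Nikodym. The induction starts from the Dirac mass at the empty tuple and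
    adds a coordinate by a product measure. Sigma-finiteness is carried along because Tonelli and
    Radon-Nikodym require it. *)
Lemma exists_lebn c : exists mu : {sigma_finite_measure set (c.-tuple R) -> \bar R},
  forall f, measurable_fun setT f -> (forall t, 0 <= f t)%E ->
    lebint f = (\int[mu]_t f t)%E.
Proof.
elim: c => [|c [mu muE]].
  exists (@dirac _ _ [tuple] R) => f mf f0 /=.
  by rewrite integral_dirac// diracT mul1e.
exists (cons_measure mu) => f mf f0.
rewrite integral_cons_measure//=.
apply: eq_integral => x _; rewrite muE//.
apply: (measurableT_comp mf).
exact: (measurable_cons (measurable_cst (x : R)) (@measurable_id _ _ _)).
Qed.

Definition lebn c := projT1 (cid (exists_lebn c)).

Lemma lebintE c f : measurable_fun setT f -> (forall t, 0 <= f t)%E ->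
  lebint f = (\int[lebn c]_t f t)%E.
Proof. exact: (projT2 (cid (exists_lebn c))). Qed.

Lemma lebintS c (f : c.+1.-tuple R -> \bar R) : lebint f =
  (\int[@lebesgue_measure R]_x lebint (fun t => f [tuple of x :: t]))%E.
Proof. by []. Qed.

Lemma measurable_consr c (x : R) :
  measurable_fun setT (fun t : c.-tuple R => [tuple of x :: t] : c.+1.-tuple R).
Proof. exact: (measurable_cons (measurable_cst (x : R)) (@measurable_id _ _ _)). Qed.

Lemma measurable_lebint_cons c (f : c.+1.-tuple R -> \bar R) :
  measurable_fun setT f -> (forall t, 0 <= f t)%E ->
  measurable_fun [set: measurableTypeR R]
    (fun x : measurableTypeR R => lebint (fun t => f [tuple of x :: t])).
Proof.
move=> mf f0.
rewrite (_ : (fun _ => _) = fubini_F (lebn c) (f \o @consp R c)).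
  apply: measurable_fun_fubini_tonelli_F => //.
    by apply: measurableT_comp => //; exact: measurable_consp.
  by move=> x; exact: f0.
apply/funext => x; rewrite lebintE//.
by apply: (measurableT_comp mf); exact: measurable_consr.
Qed.

(** The image of Lebesgue measure under a translation gives every half-open interval its length, and
    this characterises Lebesgue measure. *)
Lemma lebesgue_integral_addr (a : R) (f : R -> \bar R) :
  measurable_fun [set: measurableTypeR R] f -> (forall x, 0 <= f x)%E ->
  (\int[@lebesgue_measure R]_x f (x + a)%R = \int[@lebesgue_measure R]_x f x)%E.
Proof.
move=> mf f0; pose h := (fun x => x + a) : measurableTypeR R -> measurableTypeR R.
have mh : measurable_fun [set: measurableTypeR R] h.
  have H : measurable_fun [set: measurableTypeR R]
      (fun x : measurableTypeR R => (x : R) + a).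
    by apply: measurable_funD => //; exact: (@measurable_id _ (measurableTypeR R)).
  by move=> mT Y mY; exact: (H mT Y mY).
transitivity (\int[pushforward (@lebesgue_measure R) h]_x f x)%E.
  by rewrite ge0_integral_pushforward// preimage_setT.
apply: eq_measure_integral => A mA _.
apply/esym/(@lebesgue_measure_unique R (pushforward (@lebesgue_measure R) h)) => //.
move=> _ [[x y] _ <-]; rewrite /= /pushforward.
rewrite (_ : h @^-1` _ = `]x - a, y - a]%classic).
  by rewrite !lebesgue_measure_itv/= !lte_fin ltrD2r -!EFinB opprB addrA subrK.
by apply/seteqP; split => z /=; rewrite /h !in_itv/= => /andP[? ?]; apply/andP; split; lra.
Qed.

Lemma measurable_shiftv c (k : 'rV[int]_c) :
  measurable_fun setT (fun t : c.-tuple R => shiftv t k).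
Proof.
apply/measurable_fun_tnthP => i.
rewrite (_ : _ \o _ = (fun t => tnth t i + (k ord0 i)%:~R)).
  by apply: measurable_funD => //; exact: measurable_tnth.
by apply/funext => t /=; rewrite /shiftv tnth_mktuple.
Qed.

Lemma shiftv_cons c (k : 'rV[int]_c.+1) (x : R) (t : c.-tuple R) :
  shiftv [tuple of x :: t] k =
  [tuple of x + (k ord0 ord0)%:~R :: shiftv t (\row_i k ord0 (lift ord0 i))].
Proof.
apply: eq_from_tnth => i; rewrite /shiftv tnth_mktuple.
case: (unliftP ord0 i) => [j ->|->]; first by rewrite !tnthS tnth_mktuple mxE.
by rewrite !tnth0.
Qed.

Lemma lebint_shiftv c (k : 'rV[int]_c) (f : c.-tuple R -> \bar R) :
  measurable_fun setT f -> (forall t, 0 <= f t)%E ->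
  lebint (fun t => f (shiftv t k)) = lebint f.
Proof.
elim: c k f => [|c IH] k f mf f0 /=; first by congr f; apply: eq_from_tnth => -[].
transitivity (\int[@lebesgue_measure R]_x
    (fun x => lebint (fun t => f [tuple of x :: t])) (x + (k ord0 ord0)%:~R)%R)%E.
  apply: eq_integral => x _.
  rewrite -[RHS](IH (\row_i k ord0 (lift ord0 i)))//.
    by congr lebint; apply/funext => t; rewrite shiftv_cons.
  by apply: (measurableT_comp mf); exact: measurable_consr.
apply: (lebesgue_integral_addr ((k ord0 ord0)%:~R)
  (f := fun x => lebint (fun t => f [tuple of x :: t]))).
  exact: measurable_lebint_cons.
move=> x; rewrite lebintE//; first exact: integral_ge0.
by apply: (measurableT_comp mf); exact: measurable_consr.
Qed.

Lemma integral_shiftv c (k : 'rV[int]_c) (f : c.-tuple R -> \bar R) :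
  measurable_fun setT f -> (forall t, 0 <= f t)%E ->
  (\int[lebn c]_t f (shiftv t k) = \int[lebn c]_t f t)%E.
Proof.
move=> mf f0; rewrite -!lebintE ?lebint_shiftv//.
exact: (measurableT_comp mf (measurable_shiftv k)).
Qed.

Lemma lebint_indic c (A : set (c.-tuple R)) : measurable A ->
  lebint (fun t => (\1_A t)%:E) = lebn c A.
Proof.
move=> mA; rewrite lebintE.
- by rewrite integral_indic// setIT.
- exact/measurable_EFinP/measurable_indic.
- by move=> t; rewrite lee_fin.
Qed.

Lemma lnullE c (N : set (c.-tuple R)) : lnull N <-> (lebn c).-negligible N.
Proof.
split=> [[A [mA [NA A0]]]|[A [mA A0 NA]]]; exists A; split => //.
- by rewrite -lebint_indic.
- by rewrite lebint_indic.
Qed.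

Lemma aeE c (P : c.-tuple R -> Prop) : ae P <-> {ae lebn c, forall t, P t}.
Proof. exact: lnullE. Qed.

Lemma ae_cubeE c (P : c.-tuple R -> Prop) :
  ae_cube P <-> {ae lebn c, forall t, cube t -> P t}.
Proof.
rewrite /ae_cube lnullE /almost_everywhere/=.
suff -> : cube (c:=c) `&` [set t | ~ P t] = ~` (fun t => cube t -> P t) by [].
apply/seteqP; split => t /=; first by move=> [ct Pt] /(_ ct).
by move=> /not_implyP.
Qed.

Lemma measurable_cube c : measurable (@cube R c).
Proof.
rewrite (_ : @cube R c = \bigcap_i [set t | 0 <= tnth t i < 1]); last first.
  by apply/seteqP; split => t /= h i => [_|]; exact: h.
apply: fin_bigcap_measurable => // i _.
rewrite (_ : [set _ | _] = (@tnth c R)^~ i @^-1` `[0, 1[%classic).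
  by rewrite -[X in measurable X]setTI; apply: measurable_tnth.
by apply/seteqP; split => t /=; rewrite in_itv.
Qed.

Lemma lebn_cube c : lebn c (@cube R c) = 1%E.
Proof.
have mcub k : measurable_fun setT (fun t => (\1_(@cube R k) t)%:E : \bar R).
  by apply/measurable_EFinP; apply: measurable_indic; exact: measurable_cube.
have E k : lebint (fun t => (\1_(@cube R k) t)%:E : \bar R) = lebn k (@cube R k).
  by apply: lebint_indic; exact: measurable_cube.
elim: c => [|c IH].
  rewrite -E /= indicE mem_set//; by case.
rewrite -E lebintS.
transitivity (\int[@lebesgue_measure R]_x (\1_(`[0, 1[%classic) x)%:E)%E.
  apply: eq_integral => x _.
  transitivity (lebint (fun t => (\1_(`[0, 1[%classic) x)%:E * (\1_(@cube R c) t)%:E))%E.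
    congr lebint; apply/funext => t; rewrite -EFinM; congr EFin.
    rewrite !indicE -natrM mulnb; congr ((nat_of_bool _)%:R).
    apply/idP/andP; rewrite ?inE /cube /=.
      move=> h; split; first by have := h ord0; rewrite in_itv tnth0.
      by move=> i; have := h (lift ord0 i); rewrite tnthS.
    move=> [h0 h i].
    case: (unliftP ord0 i) => [j ->|->]; first by rewrite tnthS.
    by move: h0; rewrite in_itv tnth0.
  rewrite lebintE.
  - rewrite ge0_integralZl_EFin//; last exact: mcub.
    have mc := @measurable_cube c.
    rewrite integral_indic// setIT [X in (_ * X)%E](_ : _ = 1%E) ?mule1//; exact: IH.
  - by apply: measurable_funeM; exact: mcub.
  - by move=> t; rewrite mule_ge0.
rewrite integral_indic// setIT /=.
by rewrite lebesgue_measure_itv/= lte01 oppr0 adde0.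
Qed.

End lebn.

(** * Complex-valued integrals *)

Lemma cvg_dist_le (R : realType) (u v : nat -> R) (l : R) :
  (forall n, `|u n - l| <= v n) -> v @ \oo --> (0 : R) -> u @ \oo --> l.
Proof.
move=> uv /cvgr0Pnorm_lt v0; apply/cvgrPdist_lt => e e0.
near=> n; rewrite distrC (le_lt_trans (uv n))//.
by rewrite (le_lt_trans (ler_norm _))//; near: n; exact: v0.
Unshelve. all: by end_near.
Qed.

Section complex_modulus.
Variable R : realType.
Implicit Types z w : R[i].

Lemma cabs_ge0 z : 0 <= cabs z.
Proof. by case: z => a b; rewrite /cabs /= sqrtr_ge0. Qed.

Lemma cabs0 : cabs (0 : R[i]) = 0.
Proof. exact: Normc.normc0. Qed.

Lemma cabs_eq0 z : cabs z = 0 -> z = 0.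
Proof. exact: Normc.eq0_normc. Qed.

Lemma cabsM z w : cabs (z * w) = cabs z * cabs w.
Proof. exact: Normc.normcM. Qed.

Lemma cabsD z w : cabs (z + w) <= cabs z + cabs w.
Proof. exact: (@le_normcD R z w). Qed.

Lemma cabsN z : cabs (- z) = cabs z.
Proof. exact: (@normcN R z). Qed.

Lemma cabsBC z w : cabs (z - w) = cabs (w - z).
Proof. by rewrite -cabsN opprB. Qed.

Lemma normr_cabs z : `|cabs z| = cabs z.
Proof. by rewrite ger0_norm ?cabs_ge0. Qed.

Lemma cabs_sum (I : Type) (s : seq I) (F : I -> R[i]) :
  cabs (\sum_(i <- s) F i) <= \sum_(i <- s) cabs (F i).
Proof.
elim: s => [|a s IH]; first by rewrite !big_nil cabs0.
by rewrite !big_cons (le_trans (cabsD _ _))// lerD2l.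
Qed.

Lemma cabs_real (a : R) : cabs (Complex a 0) = `|a|.
Proof. by rewrite /cabs /= expr0n addr0 sqrtr_sqr. Qed.

Lemma Re_le_cabs z : `|complex.Re z| <= cabs z.
Proof.
by case: z => a b; rewrite /cabs /= -sqrtr_sqr ler_wsqrtr// lerDl sqr_ge0.
Qed.

Lemma Im_le_cabs z : `|complex.Im z| <= cabs z.
Proof.
by case: z => a b; rewrite /cabs /= -sqrtr_sqr ler_wsqrtr// lerDr sqr_ge0.
Qed.

Lemma cabs_le_ReIm z : cabs z <= `|complex.Re z| + `|complex.Im z|.
Proof.
have {1}-> : z = Complex (complex.Re z) 0 + Complex 0 (complex.Im z).
  by case: z => a b; apply/eqP; rewrite eq_complex /= addr0 add0r !eqxx.
rewrite (le_trans (cabsD _ _))// cabs_real lerD2l.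
by rewrite /cabs /= expr0n add0r sqrtr_sqr.
Qed.

Lemma cReD z w : complex.Re (z + w) = complex.Re z + complex.Re w.
Proof. by case: z; case: w. Qed.

Lemma cImD z w : complex.Im (z + w) = complex.Im z + complex.Im w.
Proof. by case: z; case: w. Qed.

Lemma cReB z w : complex.Re (z - w) = complex.Re z - complex.Re w.
Proof. by case: z; case: w. Qed.

Lemma cImB z w : complex.Im (z - w) = complex.Im z - complex.Im w.
Proof. by case: z; case: w. Qed.

Lemma cReM z w : complex.Re (z * w) =
  complex.Re z * complex.Re w - complex.Im z * complex.Im w.
Proof. by case: z; case: w. Qed.

Lemma cImM z w : complex.Im (z * w) =
  complex.Re z * complex.Im w + complex.Im z * complex.Re w.
Proof. by case: z; case: w. Qed.

Lemma complexP z w : complex.Re z = complex.Re w ->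
  complex.Im z = complex.Im w -> z = w.
Proof. by case: z => a b; case: w => a' b' /= -> ->. Qed.

(** Convergence in [R[i]] is expressed by a real null sequence, so that the limit theorems for real
    functions apply directly. *)
Definition ccvg (u : nat -> R[i]) l := (fun n => cabs (u n - l)) @ \oo --> (0 : R).

Lemma ccvg_Re u l : ccvg u l -> (fun n => complex.Re (u n)) @ \oo --> complex.Re l.
Proof.
by apply: cvg_dist_le => n; rewrite -cReB Re_le_cabs.
Qed.

Lemma ccvg_Im u l : ccvg u l -> (fun n => complex.Im (u n)) @ \oo --> complex.Im l.
Proof.
by apply: cvg_dist_le => n; rewrite -cImB Im_le_cabs.
Qed.

Lemma ccvg_ReIm u l : (fun n => complex.Re (u n)) @ \oo --> complex.Re l ->
  (fun n => complex.Im (u n)) @ \oo --> complex.Im l -> ccvg u l.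
Proof.
move=> ur ui; rewrite /ccvg.
apply: (@cvg_dist_le _ _ (fun n =>
  `|complex.Re (u n) - complex.Re l| + `|complex.Im (u n) - complex.Im l|)).
- move=> n; rewrite subr0 normr_cabs (le_trans (cabs_le_ReIm _))//.
  by rewrite cReB cImB.
- rewrite -[X in _ --> X](addr0 (0 : R)) -[X in _ --> X + _](@normr0 _ R).
  rewrite -[X in _ --> _ + X](@normr0 _ R).
  by apply: cvgD; apply: cvg_norm; apply/subr_cvg0.
Qed.

Lemma ccvg_unique u l m : ccvg u l -> ccvg u m -> l = m.
Proof.
move=> ul um; apply: complexP.
- exact: (cvg_unique _ (ccvg_Re ul) (ccvg_Re um)).
- exact: (cvg_unique _ (ccvg_Im ul) (ccvg_Im um)).
Qed.

Lemma ccvg_cst l : ccvg (fun=> l) l.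
Proof. by rewrite /ccvg subrr cabs0; exact: cvg_cst. Qed.

Lemma ccvgZ a u l : ccvg u l -> ccvg (fun n => a * u n) (a * l).
Proof.
move=> ul; rewrite /ccvg; under eq_fun do rewrite -mulrBr cabsM.
by rewrite -(mulr0 (cabs a)); apply: cvgM => //; exact: cvg_cst.
Qed.

Lemma ccvg_cabsB w u l : ccvg u l ->
  (fun n => cabs (w - u n)) @ \oo --> cabs (w - l).
Proof.
apply: cvg_dist_le => n; rewrite ler_norml; apply/andP; split.
- rewrite lerBrDr addrC lerBlDr.
  by rewrite (_ : w - l = (w - u n) + (u n - l)) ?cabsD// addrA subrK.
- rewrite lerBlDr (cabsBC (u n)).
  by rewrite (_ : w - u n = (l - u n) + (w - l)) ?cabsD// [RHS]addrC addrA subrK.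
Qed.

End complex_modulus.

Section complex_measurable.
Context (R : realType) (d : measure_display) (T : measurableType d).
Implicit Types f g : T -> R[i].

Definition cmeasurable f :=
  measurable_fun setT (fun t => complex.Re (f t)) /\
  measurable_fun setT (fun t => complex.Im (f t)).

Lemma cmeasurable_cst z : cmeasurable (fun=> z).
Proof. by split; exact: measurable_cst. Qed.

Lemma cmeasurable_real (f : T -> R) : measurable_fun setT f ->
  cmeasurable (fun t => Complex (f t) 0).
Proof. by move=> mf; split => //; exact: measurable_cst. Qed.

Lemma cmeasurableD f g : cmeasurable f -> cmeasurable g ->
  cmeasurable (fun t => f t + g t).
Proof.
move=> [mf1 mf2] [mg1 mg2]; split.
- by under eq_fun do rewrite cReD; exact: measurable_funD.
- by under eq_fun do rewrite cImD; exact: measurable_funD.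
Qed.

Lemma cmeasurableM f g : cmeasurable f -> cmeasurable g ->
  cmeasurable (fun t => f t * g t).
Proof.
move=> [mf1 mf2] [mg1 mg2]; split.
- by under eq_fun do rewrite cReM; apply: measurable_funB; exact: measurable_funM.
- by under eq_fun do rewrite cImM; apply: measurable_funD; exact: measurable_funM.
Qed.

Lemma cmeasurableZ a f : cmeasurable f -> cmeasurable (fun t => a * f t).
Proof. by apply: cmeasurableM; exact: cmeasurable_cst. Qed.

Lemma cmeasurableN f : cmeasurable f -> cmeasurable (fun t => - f t).
Proof. by move=> /(cmeasurableZ (-1)); under eq_fun do rewrite mulN1r. Qed.

Lemma cmeasurableB f g : cmeasurable f -> cmeasurable g ->
  cmeasurable (fun t => f t - g t).
Proof. by move=> mf mg; apply: cmeasurableD => //; exact: cmeasurableN. Qed.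

Lemma cmeasurable_sum (I : Type) (s : seq I) (F : I -> T -> R[i]) :
  (forall i, cmeasurable (F i)) -> cmeasurable (fun t => \sum_(i <- s) F i t).
Proof.
move=> mF; elim: s => [|a s IH].
  by under eq_fun do rewrite big_nil; exact: cmeasurable_cst.
by under eq_fun do rewrite big_cons; exact: cmeasurableD.
Qed.

Lemma cmeasurable_cabs f : cmeasurable f -> measurable_fun setT (fun t => cabs (f t)).
Proof.
move=> [mf1 mf2]; rewrite (_ : (fun _ => _) = fun t =>
    Num.sqrt (complex.Re (f t) ^+ 2 + complex.Im (f t) ^+ 2)); last first.
  by apply/funext => t; case: (f t).
apply: (measurableT_comp (f := @Num.sqrt R)).
  by apply: continuous_measurable_fun; exact: sqrt_continuous.
by apply: measurable_funD; exact: measurable_funX.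
Qed.

Lemma measurable_ecabs f : cmeasurable f ->
  measurable_fun setT (fun t => (cabs (f t))%:E).
Proof. by move=> /cmeasurable_cabs mf; exact/measurable_EFinP. Qed.

Lemma cmeasurable_if (D : set T) f g : measurable D ->
  cmeasurable f -> cmeasurable g ->
  cmeasurable (fun t => if `[< D t >] then f t else g t).
Proof.
move=> mD [mf1 mf2] [mg1 mg2].
have mb : measurable_fun setT (fun t => `[< D t >]).
  apply: (measurable_fun_bool true); rewrite setTI.
  rewrite (_ : _ @^-1` _ = D)//; apply/seteqP; split => t /=; first by move/asboolP.
  by move/asboolP.
split.
- under eq_fun do rewrite (fun_if (@complex.Re R)).
  exact: measurable_fun_ifT.
- under eq_fun do rewrite (fun_if (@complex.Im R)).
  exact: measurable_fun_ifT.
Qed.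

End complex_measurable.

Lemma cmeasurable_comp (R : realType) (d d' : measure_display)
    (T : measurableType d) (U : measurableType d') (f : T -> R[i]) (h : U -> T) :
  cmeasurable f -> measurable_fun setT h -> cmeasurable (fun u => f (h u)).
Proof.
move=> [mf1 mf2] mh; split.
- exact: (measurableT_comp mf1 mh).
- exact: (measurableT_comp mf2 mh).
Qed.

Section complex_integral.
Context (R : realType) (d : measure_display) (T : measurableType d).
Variable mu : {measure set T -> \bar R}.
Implicit Types f g : T -> R[i].

Definition Cintegrable f :=
  cmeasurable f /\ (\int[mu]_t (cabs (f t))%:E < +oo)%E.

Definition Cint f : R[i] :=
  Complex (Rintegral mu setT (fun t => complex.Re (f t)))
          (Rintegral mu setT (fun t => complex.Im (f t))).

Lemma le_Cintegrable f (G : T -> \bar R) : cmeasurable f ->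
  measurable_fun setT G -> (\int[mu]_t G t < +oo)%E ->
  (forall t, (cabs (f t))%:E <= G t)%E -> Cintegrable f.
Proof.
move=> mf mG Goo fG; split => //; apply: le_lt_trans Goo.
apply: ge0_le_integral => //.
- by move=> t _; rewrite lee_fin cabs_ge0.
- exact: measurable_ecabs.
Qed.

Lemma integrable_cabs f : Cintegrable f ->
  mu.-integrable setT (fun t => (cabs (f t))%:E).
Proof.
move=> [mf foo]; apply/integrableP; split; first exact: measurable_ecabs.
by under eq_integral do rewrite gee0_abs ?lee_fin ?cabs_ge0//.
Qed.

Lemma integrable_Re f : Cintegrable f ->
  mu.-integrable setT (EFin \o (fun t => complex.Re (f t))).
Proof.
move=> If; apply: le_integrable (integrable_cabs If) => //.
  by apply/measurable_EFinP; case: If => -[].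
by move=> t _ /=; rewrite lee_fin normr_cabs Re_le_cabs.
Qed.

Lemma integrable_Im f : Cintegrable f ->
  mu.-integrable setT (EFin \o (fun t => complex.Im (f t))).
Proof.
move=> If; apply: le_integrable (integrable_cabs If) => //.
  by apply/measurable_EFinP; case: If => -[].
by move=> t _ /=; rewrite lee_fin normr_cabs Im_le_cabs.
Qed.

Lemma eq_Cint f g : f =1 g -> Cint f = Cint g.
Proof. by move=> /funext ->. Qed.

Lemma CintegrableD f g : Cintegrable f -> Cintegrable g ->
  Cintegrable (fun t => f t + g t).
Proof.
move=> If Ig; apply: (@le_Cintegrable _ (fun t => (cabs (f t))%:E + (cabs (g t))%:E)%E).
- by apply: cmeasurableD; [exact: If.1|exact: Ig.1].
- by apply: emeasurable_funD; apply: measurable_ecabs; [exact: If.1|exact: Ig.1].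
- rewrite ge0_integralD//.
  + by apply: lte_add_pinfty; [exact: If.2|exact: Ig.2].
  + by move=> t _; rewrite lee_fin cabs_ge0.
  + by apply: measurable_ecabs; exact: If.1.
  + by move=> t _; rewrite lee_fin cabs_ge0.
  + by apply: measurable_ecabs; exact: Ig.1.
- by move=> t; rewrite -EFinD lee_fin cabsD.
Qed.

Lemma CintegrableZ a f : Cintegrable f -> Cintegrable (fun t => a * f t).
Proof.
move=> If; apply: (@le_Cintegrable _ (fun t => (cabs a)%:E * (cabs (f t))%:E)%E).
- by apply: cmeasurableZ; exact: If.1.
- by apply: measurable_funeM; apply: measurable_ecabs; exact: If.1.
- rewrite ge0_integralZl_EFin ?cabs_ge0//.
  + by rewrite lte_mul_pinfty ?lee_fin ?cabs_ge0//; exact: If.2.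
  + by move=> t _; rewrite lee_fin cabs_ge0.
  + by apply: measurable_ecabs; exact: If.1.
- by move=> t; rewrite -EFinM lee_fin cabsM.
Qed.

Lemma CintD f g : Cintegrable f -> Cintegrable g ->
  Cint (fun t => f t + g t) = Cint f + Cint g.
Proof.
move=> If Ig; apply: complexP => /=.
- under eq_Rintegral do rewrite cReD.
  by rewrite RintegralD//; exact: integrable_Re.
- under eq_Rintegral do rewrite cImD.
  by rewrite RintegralD//; exact: integrable_Im.
Qed.

Lemma CintZ a f : Cintegrable f -> Cint (fun t => a * f t) = a * Cint f.
Proof.
move=> If.
have Ir := integrable_Re If; have Ii := integrable_Im If.
have IrZ (r : R) : mu.-integrable setT (EFin \o (fun t => r * complex.Re (f t))).
  exact: (integrableZl measurableT r Ir).
have IiZ (r : R) : mu.-integrable setT (EFin \o (fun t => r * complex.Im (f t))).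
  exact: (integrableZl measurableT r Ii).
apply: complexP; rewrite ?cReM ?cImM /=.
- under eq_Rintegral do rewrite cReM.
  by rewrite RintegralB// !RintegralZl.
- under eq_Rintegral do rewrite cImM.
  by rewrite RintegralD// !RintegralZl.
Qed.

Lemma Cintegrable0 : Cintegrable (fun=> 0).
Proof.
split; first exact: cmeasurable_cst.
by under eq_integral do rewrite cabs0; rewrite integral0.
Qed.

Lemma Cint0 : Cint (fun=> 0) = 0.
Proof. by apply: complexP; rewrite /= /Rintegral integral0. Qed.

Lemma Cintegrable_sum (I : Type) (s : seq I) (F : I -> T -> R[i]) :
  (forall i, Cintegrable (F i)) -> Cintegrable (fun t => \sum_(i <- s) F i t).
Proof.
move=> IF; elim: s => [|a s IH].
  by under eq_fun do rewrite big_nil; exact: Cintegrable0.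
by under eq_fun do rewrite big_cons; exact: CintegrableD.
Qed.

Lemma Cint_sum (I : Type) (s : seq I) (F : I -> T -> R[i]) :
  (forall i, Cintegrable (F i)) ->
  Cint (fun t => \sum_(i <- s) F i t) = \sum_(i <- s) Cint (F i).
Proof.
move=> IF; elim: s => [|a s IH].
  by rewrite big_nil -[RHS]Cint0; apply: eq_Cint => t; rewrite big_nil.
rewrite big_cons -IH -CintD//; first by apply: eq_Cint => t; rewrite big_cons.
exact: Cintegrable_sum.
Qed.

Lemma Rintegral_dct (f_ : nat -> T -> R) (f : T -> R) (G : T -> \bar R) :
  (forall n, measurable_fun setT (f_ n)) -> measurable_fun setT f ->
  {ae mu, forall t, (f_ ^~ t) @ \oo --> f t} -> mu.-integrable setT G ->
  (forall n t, `|f_ n t|%:E <= G t)%E ->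
  (fun n => Rintegral mu setT (f_ n)) @ \oo --> Rintegral mu setT f.
Proof.
move=> mf_ mf ff IG fG.
have [|||||If _ +] := @dominated_convergence _ _ _ mu setT measurableT
    (fun n t => (f_ n t)%:E) (fun t => (f t)%:E) G.
- by move=> n; exact/measurable_EFinP.
- exact/measurable_EFinP.
- by apply: filterS ff => t ft _; apply: cvg_EFin => //; exact: nearW.
- exact: IG.
- by apply: nearW => t n _; exact: fG.
have [r Er] : exists r, (\int[mu]_x (f x)%:E)%E = r%:E.
  by exists (fine (\int[mu]_x (f x)%:E)%E); rewrite fineK// integrable_fin_num.
by rewrite /Rintegral Er => /fine_cvg.
Qed.

Lemma Cint_dct (f_ : nat -> T -> R[i]) f (G : T -> \bar R) :
  (forall n, cmeasurable (f_ n)) -> cmeasurable f ->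
  {ae mu, forall t, ccvg (f_ ^~ t) (f t)} ->
  measurable_fun setT G -> (\int[mu]_t G t < +oo)%E ->
  (forall n t, (cabs (f_ n t))%:E <= G t)%E ->
  Cintegrable f /\ ccvg (fun n => Cint (f_ n)) (Cint f).
Proof.
move=> mf_ mf ff mG Goo fG.
have G0 t : (0 <= G t)%E.
  by apply: le_trans (fG 0%N t); rewrite lee_fin cabs_ge0.
have IG : mu.-integrable setT G.
  apply/integrableP; split => //.
  by under eq_integral do rewrite gee0_abs//.
have If_ n : Cintegrable (f_ n) by exact: le_Cintegrable mG Goo (fG n).
(* [G] bounds the limit [f] only almost everywhere, so its integrability is taken from dominated
   convergence for the moduli. *)
have If : Cintegrable f.
  have [|||//] := @dominated_convergence _ _ _ mu setT measurableT
    (fun n t => (cabs (f_ n t))%:E) (fun t => (cabs (f t))%:E) G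
    (fun n => measurable_ecabs (mf_ n)) (measurable_ecabs mf).
  - apply: filterS ff => t ft _; apply: cvg_EFin; first exact: nearW.
    have := @ccvg_cabsB R 0 _ _ ft; rewrite sub0r cabsN.
    by under eq_fun do rewrite sub0r cabsN.
  - exact: IG.
  - by apply: nearW => t n _; rewrite gee0_abs ?lee_fin ?cabs_ge0//; exact: fG.
  - move=> /integrableP[_] foo _ _; split => //.
    by move: foo; under eq_integral do rewrite gee0_abs ?lee_fin ?cabs_ge0//.
split => //; apply: ccvg_ReIm => /=.
- apply: Rintegral_dct IG _ => //.
  + by move=> n; exact: (mf_ n).1.
  + exact: mf.1.
  + by apply: filterS ff => t; exact: ccvg_Re.
  + by move=> n t; apply: le_trans (fG n t); rewrite lee_fin Re_le_cabs.
- apply: Rintegral_dct IG _ => //.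
  + by move=> n; exact: (mf_ n).2.
  + exact: mf.2.
  + by apply: filterS ff => t; exact: ccvg_Im.
  + by move=> n t; apply: le_trans (fG n t); rewrite lee_fin Im_le_cabs.
Qed.

End complex_integral.

(** * The integrals of the statement as integrals against [lebn] *)

Section defs_as_integrals.
Context (R : realType) (c : nat).
Local Notation T := (c.-tuple R).
Local Notation mu := (lebn R c).
Implicit Types f : T -> R[i].

Lemma cintegrableE f : cintegrable f <-> Cintegrable mu f.
Proof.
split=> -[mf foo]; split => //; move: foo; rewrite lebintE//.
- exact: measurable_ecabs.
- by move=> t; rewrite lee_fin cabs_ge0.
- exact: measurable_ecabs.
- by move=> t; rewrite lee_fin cabs_ge0.
Qed.

(** One side applies [fine] to each of the positive and negative parts, the other to their
    difference. Integrability makes both parts finite, so the two agree. *)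
Lemma rintE (f : T -> R) : mu.-integrable setT (EFin \o f) ->
  rint f = Rintegral mu setT f.
Proof.
move=> If; have mf : measurable_fun setT f.
  by apply/measurable_EFinP; case/integrableP : If.
rewrite /rint /Rintegral integralE !lebintE.
- rewrite [RHS]fineB.
  + congr (_ - _); congr fine; apply: eq_integral => t _.
      by rewrite funepos.unlock EFin_max.
    by rewrite funeneg.unlock EFin_max.
  + exact: (integrable_pos_fin_num measurableT If).
  + exact: (integrable_neg_fin_num measurableT If).
- by apply/measurable_EFinP; apply: measurable_maxr => //; exact: measurableT_comp.
- by move=> t; rewrite lee_fin le_max lexx orbT.
- by apply/measurable_EFinP; apply: measurable_maxr.
- by move=> t; rewrite lee_fin le_max lexx orbT.
Qed.

Lemma cintE f : Cintegrable mu f -> cint f = Cint mu f.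
Proof.
move=> If; apply: complexP => /=; apply: rintE.
- exact: integrable_Re.
- exact: integrable_Im.
Qed.

End defs_as_integrals.

(** * The spaces L_p *)

Lemma measurable_fun_limn_einf (R : realType) (d : measure_display)
    (T : measurableType d) (f_ : nat -> T -> \bar R) :
  (forall n, measurable_fun setT (f_ n)) ->
  measurable_fun setT (fun t => limn_einf (f_ ^~ t)).
Proof.
move=> mf_; rewrite (_ : (fun _ => _) = (fun t => - limn_esup (fun n => - f_ n t))%E).
  apply: measurableT_comp => //; apply: measurable_fun_limn_esup => n.
  exact: measurableT_comp.
by apply/funext => t; rewrite limn_esupN oppeK.
Qed.

Section Lp_space.
Context (R : realType) (c : nat) (p : R).
Hypothesis p1 : 1 <= p.
Local Notation T := (c.-tuple R).
Local Notation mu := (lebn R c).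
Implicit Types y z : T -> R[i].

Let p0 : 0 < p. Proof. exact: lt_le_trans p1. Qed.
Let p_ge0 : 0 <= p. Proof. exact: ltW. Qed.
Let pn0 : p != 0. Proof. exact: lt0r_neq0. Qed.

Definition Np y := (\int[mu]_t (cabs (y t) `^ p)%:E)%E.

Lemma measurable_cabs_powR y : cmeasurable y ->
  measurable_fun setT (fun t => (cabs (y t) `^ p)%:E).
Proof.
move=> /cmeasurable_cabs my; apply/measurable_EFinP.
exact: (measurableT_comp (measurable_powR p) my).
Qed.

Lemma lebint_Np y : cmeasurable y -> lebint (fun t => (cabs (y t) `^ p)%:E) = Np y.
Proof.
move=> my; rewrite lebintE//; first exact: measurable_cabs_powR.
by move=> t; rewrite lee_fin powR_ge0.
Qed.

Lemma Np_ge0 y : (0 <= Np y)%E.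
Proof. by apply: integral_ge0 => t _; rewrite lee_fin powR_ge0. Qed.

Lemma LpE y : Lp p y <-> cmeasurable y /\ (Np y < +oo)%E.
Proof. by split=> -[my]; [rewrite lebint_Np|rewrite -lebint_Np]. Qed.

Lemma lpnormE y : cmeasurable y -> lpnorm p y = fine (Np y) `^ p^-1.
Proof. by move=> my; rewrite /lpnorm lebint_Np. Qed.

Lemma lpnorm_ge0 y : 0 <= lpnorm p y.
Proof. exact: powR_ge0. Qed.

Lemma NpE y : Lp p y -> Np y = (lpnorm p y `^ p)%:E.
Proof.
move=> /LpE[my yoo]; rewrite lpnormE// -powRrM mulVf// powRr1.
  by rewrite fineK// ge0_fin_numE// Np_ge0.
by rewrite fine_ge0// Np_ge0.
Qed.

Lemma powR_le (a b : R) : 0 <= a -> a <= b -> a `^ p <= b `^ p.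
Proof.
move=> a0 ab; apply: ge0_ler_powR => //; rewrite nnegrE//; exact: le_trans ab.
Qed.

Lemma powRV_le (a b : R) : 0 <= a -> a <= b -> a `^ p^-1 <= b `^ p^-1.
Proof.
move=> a0 ab; apply: ge0_ler_powR; rewrite ?nnegrE ?invr_ge0//; exact: le_trans ab.
Qed.

Lemma le_Np y z : cmeasurable y -> cmeasurable z ->
  (forall t, cabs (y t) <= cabs (z t)) -> (Np y <= Np z)%E.
Proof.
move=> my mz yz; apply: ge0_le_integral => //.
- by move=> t _; rewrite lee_fin powR_ge0.
- exact: measurable_cabs_powR.
- exact: measurable_cabs_powR.
- by move=> t _; rewrite lee_fin powR_le ?cabs_ge0.
Qed.

Lemma le_Lp y z : cmeasurable y -> Lp p z ->
  (forall t, cabs (y t) <= cabs (z t)) -> Lp p y /\ lpnorm p y <= lpnorm p z.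
Proof.
move=> my /LpE[mz zoo] yz; have yzN := le_Np my mz yz.
have yoo : (Np y < +oo)%E by exact: le_lt_trans zoo.
split; first exact/LpE.
rewrite (lpnormE my) (lpnormE mz); apply: powRV_le; first by rewrite fine_ge0 ?Np_ge0.
by apply: fine_le => //; rewrite ge0_fin_numE; do ?exact: Np_ge0.
Qed.

Lemma NpZ a y : cmeasurable y -> Np (fun t => a * y t) = ((cabs a `^ p)%:E * Np y)%E.
Proof.
move=> my; rewrite /Np; under eq_integral do rewrite cabsM powRM ?cabs_ge0// EFinM.
rewrite ge0_integralZl_EFin ?powR_ge0//.
- by move=> t _; rewrite lee_fin powR_ge0.
- exact: measurable_cabs_powR.
Qed.

Lemma LpZ a y : Lp p y -> Lp p (fun t => a * y t).
Proof.
move=> /LpE[my yoo]; apply/LpE; split; first exact: cmeasurableZ.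
by rewrite NpZ// lte_mul_pinfty ?lee_fin ?powR_ge0.
Qed.

Lemma lpnormZ a y : Lp p y -> lpnorm p (fun t => a * y t) = cabs a * lpnorm p y.
Proof.
move=> Ly; have [my yoo] := (LpE _).1 Ly.
rewrite lpnormE; last exact: cmeasurableZ.
rewrite NpZ// NpE//= -powRM ?cabs_ge0 ?lpnorm_ge0//.
rewrite -powRrM mulfV// powRr1// mulr_ge0 ?cabs_ge0 ?lpnorm_ge0//.
Qed.

(** From |y + z| <= 2 max(|y|, |z|) follows |y + z|^p <= 2^p (|y|^p + |z|^p). *)
Lemma LpD y z : Lp p y -> Lp p z -> Lp p (fun t => y t + z t).
Proof.
move=> /LpE[my yoo] /LpE[mz zoo]; apply/LpE; split; first exact: cmeasurableD.
apply: (@le_lt_trans _ _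
  (\int[mu]_t ((2 `^ p)%:E * ((cabs (y t) `^ p)%:E + (cabs (z t) `^ p)%:E)))%E).
  apply: ge0_le_integral => //.
  - by move=> t _; rewrite lee_fin powR_ge0.
  - by apply: measurable_cabs_powR; exact: cmeasurableD.
  - apply: measurable_funeM; apply: emeasurable_funD; exact: measurable_cabs_powR.
  - move=> t _; rewrite -EFinD -EFinM lee_fin.
    wlog yz : y z {my yoo mz zoo} / cabs (y t) <= cabs (z t).
      move=> H; case: (leP (cabs (y t)) (cabs (z t))) => [|/ltW] yz; first exact: H.
      by rewrite addrC [X in _ * X]addrC; exact: H.
    apply: (@le_trans _ _ ((2 * cabs (z t)) `^ p)).
      apply: powR_le; first exact: cabs_ge0.
      by rewrite (le_trans (cabsD _ _))// mulr_natl mulr2n lerD2r.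
    rewrite powRM ?cabs_ge0//.
    by rewrite ler_wpM2l ?powR_ge0// lerDr powR_ge0.
rewrite ge0_integralZl_EFin ?powR_ge0//.
- rewrite lte_mul_pinfty ?lee_fin ?powR_ge0//.
  rewrite ge0_integralD//.
  + exact: (lte_add_pinfty yoo zoo).
  + by move=> t _; rewrite lee_fin powR_ge0.
  + exact: measurable_cabs_powR.
  + by move=> t _; rewrite lee_fin powR_ge0.
  + exact: measurable_cabs_powR.
- by move=> t _; rewrite adde_ge0// lee_fin powR_ge0.
- by apply: emeasurable_funD; exact: measurable_cabs_powR.
Qed.

Lemma LpB y z : Lp p y -> Lp p z -> Lp p (fun t => y t - z t).
Proof.
move=> Ly /(LpZ (-1)); under eq_fun do rewrite mulN1r; exact: LpD.
Qed.

Lemma Lp0 : Lp p (fun _ : T => 0).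
Proof.
apply/LpE; split; first exact: cmeasurable_cst.
by rewrite /Np; under eq_integral do rewrite cabs0 powR0//; rewrite integral0.
Qed.

Lemma Lp_sum (I : Type) (s : seq I) (F : I -> T -> R[i]) :
  (forall i, Lp p (F i)) -> Lp p (fun t => \sum_(i <- s) F i t).
Proof.
move=> IF; elim: s => [|a s IH].
  by under eq_fun do rewrite big_nil; exact: Lp0.
by under eq_fun do rewrite big_cons; exact: LpD.
Qed.

(* The pointwise bound |y| <= e + e^(1-p) |y|^p, integrated over the unit cube,
   replaces Hoelder's inequality at the price of the constant 2. *)
Lemma L1_le_lpnorm y : Lp p y -> (forall t, ~ cube t -> y t = 0) ->
  (\int[mu]_t (cabs (y t))%:E <= (2 * lpnorm p y)%:E)%E.
Proof.
move=> Ly y0; have [my yoo] := (LpE _).1 Ly.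
(* Taking e strictly above the norm keeps e positive even when the norm is 0; the slack is removed
   at once. *)
suff H e : lpnorm p y < e -> (\int[mu]_t (cabs (y t))%:E <= (2 * e)%:E)%E.
  apply/lee_addgt0Pr => e e0.
  rewrite -EFinD (_ : 2 * lpnorm p y + e = 2 * (lpnorm p y + e / 2)).
    by apply: H; rewrite ltrDl divr_gt0.
  by rewrite mulrDr; congr (_ + _); rewrite mulrC divfK.
move=> ye; have e0 : 0 < e := le_lt_trans (lpnorm_ge0 y) ye.
apply: (@le_trans _ _ (\int[mu]_t (e%:E * (\1_(@cube R c) t)%:E +
    (e `^ (1 - p))%:E * (cabs (y t) `^ p)%:E))%E).
  apply: ge0_le_integral => //.
  - by move=> t _; rewrite lee_fin cabs_ge0.
  - exact: measurable_ecabs.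
  - apply: emeasurable_funD; apply: measurable_funeM.
      by apply/measurable_EFinP; apply: measurable_indic; exact: measurable_cube.
    exact: measurable_cabs_powR.
  - move=> t _; rewrite -!EFinM -EFinD lee_fin.
    have [ct|nct] := pselect (cube t); last first.
      by rewrite y0// cabs0 addr_ge0 ?mulr_ge0 ?powR_ge0// ltW.
    rewrite indicE mem_set// mulr1.
    (* Up to e the first term suffices. Above e, as 1 - p <= 0, one has |y| = |y|^(1-p) |y|^p <=
       e^(1-p) |y|^p. *)
    have [le|lt] := leP (cabs (y t)) e.
      by rewrite (le_trans le)// lerDl mulr_ge0 ?powR_ge0.
    rewrite (@le_trans _ _ (e `^ (1 - p) * cabs (y t) `^ p))//; last by rewrite lerDr ltW.
    have cy0 : 0 < cabs (y t) by exact: lt_trans lt.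
    rewrite -{1}(powRr1 (cabs_ge0 (y t))).
    have -> : cabs (y t) `^ 1 = cabs (y t) `^ (1 - p) * cabs (y t) `^ p.
      by rewrite -powRD ?subrK//; apply/implyP => _; rewrite gt_eqF.
    rewrite ler_wpM2r ?powR_ge0//.
    rewrite -opprB !powRN lef_pV2 ?posrE ?powR_gt0//.
    by apply: ge0_ler_powR; rewrite ?nnegrE ?subr_ge0// ltW.
rewrite ge0_integralD//.
- rewrite !ge0_integralZl_EFin ?powR_ge0//.
  + have mc := @measurable_cube R c.
    rewrite integral_indic// setIT [X in (_ * X + _)%E](_ : _ = 1%E); last exact: lebn_cube.
    rewrite mule1 -/(Np y) NpE// -EFinM -EFinD lee_fin mulr_natl mulr2n lerD2l.
    (* The cube contributes e and the power term at most e^(1-p) e^p = e, whence the factor 2. *)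
    apply: (@le_trans _ _ (e `^ (1 - p) * e `^ p)).
      by rewrite ler_wpM2l ?powR_ge0// powR_le ?lpnorm_ge0// ltW.
    rewrite -powRD; first by rewrite subrK powRr1// ltW.
    by apply/implyP => _; rewrite gt_eqF.
  + by move=> t _; rewrite lee_fin powR_ge0.
  + exact: measurable_cabs_powR.
  + by apply/measurable_EFinP; apply: measurable_indic; exact: measurable_cube.
  + exact: ltW.
- by move=> t _; rewrite mule_ge0// lee_fin ltW.
- apply: measurable_funeM.
  by apply/measurable_EFinP; apply: measurable_indic; exact: measurable_cube.
- by move=> t _; rewrite mule_ge0// lee_fin powR_ge0.
- by apply: measurable_funeM; exact: measurable_cabs_powR.
Qed.

(** The differences vanish off the cube, so [L1_le_lpnorm] turns L_p convergence into L_1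
    convergence. Fatou then gives liminf |F - S_n| = 0 almost everywhere, and this liminf is |F - S|
    wherever S_n converges to S. It serves twice: for the nuclear series and for the sums over
    boxes. *)
Lemma Lp_ae_lim (F S : T -> R[i]) (S_ : nat -> T -> R[i]) :
  (forall n, Lp p (fun t => F t - S_ n t)) ->
  (forall n t, ~ cube t -> F t - S_ n t = 0) ->
  (fun n => lpnorm p (fun t => F t - S_ n t)) @ \oo --> (0 : R) ->
  {ae mu, forall t, ccvg (S_ ^~ t) (S t)} -> {ae mu, forall t, F t = S t}.
Proof.
move=> LFS FS0 cv0 aeS.
pose f n t := (cabs (F t - S_ n t))%:E.
have mf n : measurable_fun setT (f n).
  by apply: measurable_ecabs; exact: ((LpE _).1 (LFS n)).1.
have f0 n t : (0 <= f n t)%E by rewrite lee_fin cabs_ge0.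
have If0 : (fun n => \int[mu]_t f n t)%E @ \oo --> 0%E.
  apply: (@squeeze_cvge _ _ _ _ (cst 0%E) _
     (fun n => (2 * lpnorm p (fun t => F t - S_ n t))%:E)).
  - apply: nearW => n; rewrite integral_ge0//=.
    by apply: L1_le_lpnorm => // t ct; exact: FS0.
  - exact: cvg_cst.
  - apply: cvg_EFin; first exact: nearW.
    by rewrite -(mulr0 (2 : R)); apply: cvgM => //; exact: cvg_cst.
have einf0 t : (0 <= limn_einf (f ^~ t))%E.
  rewrite limn_einf_lim; apply: lime_ge; first exact: is_cvg_einfs.
  apply: nearW => n; apply: le_ereal_inf_tmp => _ [k _ <-]; exact: f0.
have : (\int[mu]_t limn_einf (f ^~ t) = 0)%E.
  apply/eqP; rewrite eq_le integral_ge0// andbT.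
  by rewrite (le_trans (fatou _ _ _ _))// (cvg_limn_einf_sup If0).1.
have mei := measurable_fun_limn_einf mf.
under eq_integral do rewrite -[limn_einf _]gee0_abs//.
move=> /ae_eq_integral_abs -/(_ measurableT mei) H.
have {}H : {ae mu, forall t, limn_einf (f ^~ t) = 0%E} by apply: filterS H => t; exact.
apply: filterS2 H aeS => t ft0 St.
have /cvg_limn_einf_sup[E _] : (f ^~ t) @ \oo --> (cabs (F t - S t))%:E.
  by apply: cvg_EFin; [exact: nearW|exact: ccvg_cabsB].
by move: ft0; rewrite E => -[/cabs_eq0/eqP]; rewrite subr_eq0 => /eqP.
Qed.

Lemma lpnorm_dct (y_ : nat -> T -> R[i]) y Y :
  (forall n, cmeasurable (y_ n)) -> cmeasurable y -> Lp p Y ->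
  (forall n t, cabs (y_ n t) <= cabs (Y t)) -> (forall t, cabs (y t) <= cabs (Y t)) ->
  (forall t, ccvg (y_ ^~ t) (y t)) ->
  (fun n => lpnorm p (fun t => y_ n t - y t)) @ \oo --> (0 : R).
Proof.
move=> my_ my LY yY_ yY ycvg.
have [mY Yoo] := (LpE _).1 LY.
have mD n : cmeasurable (fun t => y_ n t - y t) by exact: cmeasurableB.
(* |y_n - y| <= |2 Y|, so |2 Y|^p is the dominating function. *)
have L2 : Lp p (fun t => Complex 2 0 * Y t) by exact: LpZ.
have le2 n t : cabs (y_ n t - y t) <= cabs (Complex 2 0 * Y t).
  rewrite cabsM cabs_real ger0_norm// (le_trans (cabsD _ _))// cabsN.
  by rewrite mulr_natl mulr2n lerD.
have LD n : Lp p (fun t => y_ n t - y t) by case: (le_Lp (mD n) L2 (le2 n)).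
(* Needed with q = p under the integral sign and with q = 1/p for the norm itself. *)
have pow0 (u : nat -> R) (q : R) : 0 < q -> (forall n, 0 <= u n) -> u @ \oo --> (0 : R) ->
    (fun n => u n `^ q) @ \oo --> (0 : R).
  move=> q0 u0 /cvgr0Pnorm_lt uc; apply/cvgr0Pnorm_lt => e e0.
  near=> n; rewrite ger0_norm ?powR_ge0//.
  rewrite -[e](@powRr1 _ e) ?ltW// -(mulVf (lt0r_neq0 q0)) powRrM.
  apply: gt0_ltr_powR => //; rewrite ?nnegrE ?powR_ge0//.
  by rewrite -(ger0_norm (u0 n)); near: n; apply: uc; rewrite powR_gt0.
have [|||||_ _ +] := @dominated_convergence _ _ _ mu setT measurableT
    (fun n t => (cabs (y_ n t - y t) `^ p)%:E) (cst 0%E)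
    (fun t => (cabs (Complex 2 0 * Y t) `^ p)%:E).
- by move=> n; exact: measurable_cabs_powR.
- exact: measurable_cst.
- apply: nearW => t _; apply: cvg_EFin; first exact: nearW.
  apply: (pow0 (fun n => cabs (y_ n t - y t)) p p0 _ (ycvg t)) => n; exact: cabs_ge0.
- apply/integrableP; split.
    by apply: measurable_cabs_powR; exact: ((LpE _).1 L2).1.
  under eq_integral do rewrite gee0_abs ?lee_fin ?powR_ge0//.
  exact: ((LpE _).1 L2).2.
- apply: nearW => t n _; rewrite gee0_abs ?lee_fin ?powR_ge0//.
  by apply: powR_le => //; exact: cabs_ge0.
rewrite integral0 => /fine_cvg Hc.
rewrite (_ : (fun n => _) = (fun n => fine (Np (fun t => y_ n t - y t)) `^ p^-1)); last first.
  by apply/funext => n; rewrite lpnormE.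
apply: pow0; [by rewrite invr_gt0| |exact: Hc].
by move=> n; rewrite fine_ge0// Np_ge0.
Unshelve. all: by end_near.
Qed.

End Lp_space.

Lemma fatou_le (R : realType) (d : measure_display) (T : measurableType d)
    (mu : {measure set T -> \bar R}) (f_ : nat -> T -> \bar R) (f : T -> \bar R) b :
  (forall n, measurable_fun setT (f_ n)) -> (forall n t, 0 <= f_ n t)%E ->
  measurable_fun setT f -> (forall t, 0 <= f t)%E ->
  (forall t, f t <= limn_einf (f_ ^~ t))%E ->
  (forall n, \int[mu]_t f_ n t <= b)%E -> (\int[mu]_t f t <= b)%E.
Proof.
move=> mf_ f_0 mf f0 fle fb.
have mei := measurable_fun_limn_einf mf_.
apply: (@le_trans _ _ (\int[mu]_t limn_einf (f_ ^~ t))%E).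
  by apply: ge0_le_integral => // t _; exact: (le_trans (f0 t)).
apply: le_trans (fatou _ _ _ _) _ => //.
rewrite limn_einf_lim; apply: lime_le; first exact: is_cvg_einfs.
by apply: nearW => n; apply: le_trans (fb n); apply: ereal_inf_lbound; exists n => /=.
Qed.

(** * L_p of the cube as the functions in L_p that vanish off the cube *)

Section cut_to_cube.
Context (R : realType) (c : nat) (p : R).
Hypothesis p1 : 1 <= p.
Local Notation T := (c.-tuple R).
Local Notation mu := (lebn R c).
Implicit Types y z : T -> R[i].

(** [Lpc] and [lpcnorm] look at values on the cube only. Extension by zero embeds them in [Lp] and
    [lpnorm], so that one set of lemmas serves both spaces. *)
Definition cutc y : T -> R[i] := fun t => if `[< cube t >] then y t else 0.

Lemma cutE y t : cube t -> cutc y t = y t.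
Proof. by move=> ct; rewrite /cutc asboolT. Qed.

Lemma cut0 y t : ~ cube t -> cutc y t = 0.
Proof. by move=> ct; rewrite /cutc asboolF. Qed.

Lemma cut_id y : (forall t, ~ cube t -> y t = 0) -> cutc y = y.
Proof.
move=> y0; apply/funext => t; rewrite /cutc; case: asboolP => // ct.
by rewrite y0.
Qed.

Lemma cutK y : cutc (cutc y) = cutc y.
Proof. by apply: cut_id => t; exact: cut0. Qed.

Lemma cabs_cut_le y t : cabs (cutc y t) <= cabs (y t).
Proof. by rewrite /cutc; case: asboolP => // _; rewrite cabs0 cabs_ge0. Qed.

Lemma cmeasurable_cut y : cmeasurable y -> cmeasurable (cutc y).
Proof.
by move=> my; apply: cmeasurable_if => //; exact: measurable_cube.
Qed.

Lemma cut_pow y : (fun t => (\1_(@cube R c) t * cabs (y t) `^ p)%:E) =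
  (fun t => (cabs (cutc y t) `^ p)%:E).
Proof.
apply/funext => t; congr EFin; rewrite indicE.
have [ct|ct] := pselect (cube t).
- by rewrite cutE// mem_set// mul1r.
- by rewrite cut0// memNset// mul0r cabs0 powR0// lt0r_neq0// (lt_le_trans _ p1).
Qed.

Lemma LpcE y : Lpc p y <-> Lp p (cutc y).
Proof. by rewrite /Lpc /Lp cut_pow. Qed.

Lemma lpcnormE y : lpcnorm p y = lpnorm p (cutc y).
Proof. by rewrite /lpcnorm /lpnorm cut_pow. Qed.

Lemma Lpc_Lp y : Lp p y -> Lpc p y.
Proof.
move=> Ly; apply/LpcE; have [my _] := (LpE _ _).1 Ly.
exact: (le_Lp p1 (cmeasurable_cut my) Ly (cabs_cut_le y)).1.
Qed.

Lemma lpcnorm_le y : Lp p y -> lpcnorm p y <= lpnorm p y.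
Proof.
move=> Ly; rewrite lpcnormE; have [my _] := (LpE _ _).1 Ly.
exact: (le_Lp p1 (cmeasurable_cut my) Ly (cabs_cut_le y)).2.
Qed.

Lemma cutB y z : cutc (fun t => y t - z t) = (fun t => cutc y t - cutc z t).
Proof. by apply/funext => t; rewrite /cutc; case: asboolP => // _; rewrite subr0. Qed.

Lemma Lpc0 : Lpc p (fun _ : T => 0).
Proof. by apply: Lpc_Lp; exact: Lp0. Qed.

Lemma lpcnorm0 : lpcnorm p (fun _ : T => 0) = 0.
Proof.
have pn0 : p != 0 by rewrite lt0r_neq0// (lt_le_trans _ p1).
rewrite lpcnormE (_ : cutc _ = (fun=> 0)); last first.
  by apply/funext => t; rewrite /cutc if_same.
rewrite (lpnormE p (@cmeasurable_cst R _ T 0)) /Np.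
under eq_integral do rewrite cabs0 powR0//.
by rewrite integral0 /= powR0// invr_neq0.
Qed.

Lemma Lp_cube_cst (k : R[i]) : Lp p (cutc (fun=> k)).
Proof.
apply/LpE => //; split; first by apply: cmeasurable_cut; exact: cmeasurable_cst.
rewrite /Np -cut_pow; under eq_integral do rewrite EFinM muleC.
rewrite ge0_integralZl_EFin ?powR_ge0//.
- have mc := @measurable_cube R c.
  rewrite integral_indic// setIT [X in (_ * X)%E](_ : _ = 1%E) ?mule1 ?ltry//.
  exact: lebn_cube.
- by apply/measurable_EFinP; apply: measurable_indic; exact: measurable_cube.
Qed.

Lemma Lp_bounded y (M : R) : cmeasurable y -> (forall t, cabs (y t) <= M) ->
  Lp p (cutc y).
Proof.
move=> my yM; have := Lp_cube_cst (Complex M 0).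
have mcy := cmeasurable_cut my.
move=> /(le_Lp p1 mcy)[]// t; rewrite /cutc; case: asboolP => // _.
by rewrite cabs_real (le_trans (yM t))// ler_norm.
Qed.

End cut_to_cube.

(** * The dual of L_p of the cube *)

Section riesz.
Context (R : realType) (c : nat) (p : R).
Hypothesis p1 : 1 <= p.
Local Notation T := (c.-tuple R).
Local Notation mu := (lebn R c).
Implicit Types y z : T -> R[i].
Variable a : (T -> R[i]) -> R[i].
Hypothesis da : dual_elt p a.

Lemma dual_eq y z : Lpc p y -> Lpc p z -> (forall t, cube t -> y t = z t) -> a y = a z.
Proof.
case: da => aeq _ _ Ly Lz yz; apply: aeq => //; apply/ae_cubeE; exact: nearW.
Qed.

Lemma dual_cut y : Lpc p y -> a (cutc y) = a y.
Proof.
move=> Ly; apply: dual_eq => //; last by move=> t; exact: cutE.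
by apply/LpcE => //; rewrite cutK; exact/LpcE.
Qed.

Lemma dual_lin l y z : Lpc p y -> Lpc p z ->
  a (fun s => l * y s + z s) = l * a y + a z.
Proof. by case: da => _ + _; exact. Qed.

Lemma dual0 : a (fun=> 0) = 0.
Proof.
have := dual_lin 1 (Lpc0 c p1) (Lpc0 c p1).
under eq_fun do rewrite mulr0 addr0.
by rewrite mul1r => /eqP; rewrite -subr_eq0 opprD addNKr oppr_eq0 => /eqP.
Qed.

Lemma dualZ l y : Lpc p y -> a (fun s => l * y s) = l * a y.
Proof.
move=> Ly; have := dual_lin l Ly (Lpc0 c p1); rewrite dual0 addr0 => <-.
by congr a; apply/funext => t; rewrite addr0.
Qed.

Lemma dualD y z : Lpc p y -> Lpc p z -> a (fun s => y s + z s) = a y + a z.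
Proof.
move=> Ly Lz; have := dual_lin 1 Ly Lz; rewrite mul1r => <-.
by congr a; apply/funext => t; rewrite mul1r.
Qed.

Lemma dualnorm_fin_num : dualnorm p a \is a fin_num.
Proof.
have [_ _ [M aM]] := da.
rewrite ge0_fin_numE.
- apply: (@le_lt_trans _ _ (`|M|)%:E); last exact: ltry.
  apply: ge_ereal_sup => _ [y [Ly y1] <-]; rewrite lee_fin (le_trans (aM _ Ly))//.
  rewrite (le_trans (ler_norm _))// normrM ler_piMr//.
  by rewrite ger0_norm// (lpcnormE p1) lpnorm_ge0.
- apply: ereal_sup_ubound; exists (fun=> 0); last by rewrite dual0 cabs0.
  by split; [exact: Lpc0|rewrite lpcnorm0].
Qed.

Lemma dualnorm_ge0 : 0 <= fine (dualnorm p a).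
Proof.
rewrite fine_ge0//; apply: ereal_sup_ge; exists (cabs (a (fun=> 0)))%:E; last first.
  by rewrite lee_fin cabs_ge0.
by exists (fun=> 0) => //; split; [exact: Lpc0|rewrite lpcnorm0].
Qed.

Lemma dual_bound y : Lpc p y -> cabs (a y) <= fine (dualnorm p a) * lpcnorm p y.
Proof.
move=> Ly; have N0 : 0 <= lpcnorm p y by rewrite (lpcnormE p1) lpnorm_ge0.
(* Dividing by the norm requires it to be nonzero; at norm 0 the boundedness constant of [a] already
   forces |a y| <= 0. *)
have [y0|yn0] := eqVneq (lpcnorm p y) 0.
  have [_ _ [M aM]] := da.
  by rewrite y0 mulr0 (le_trans (aM _ Ly))// y0 mulr0.
have Np : 0 < lpcnorm p y by rewrite lt0r yn0.
have := @ereal_sup_ubound _ [set (cabs (a y))%:E | y in [set y | Lpc p y /\ lpcnorm p y <= 1]]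
  (cabs (a (fun t => Complex (lpcnorm p y)^-1 0 * y t)))%:E.
rewrite -/(dualnorm p a) -(fineK dualnorm_fin_num) lee_fin dualZ// cabsM cabs_real.
rewrite ger0_norm ?invr_ge0// mulrC ler_pdivrMr//; apply.
exists (fun t => Complex (lpcnorm p y)^-1 0 * y t).
  have E : cutc (fun t => Complex (lpcnorm p y)^-1 0 * y t) =
      (fun t => Complex (lpcnorm p y)^-1 0 * cutc y t).
    by apply/funext => t; rewrite /cutc; case: asboolP => // _; rewrite mulr0.
  have Lcy : Lp p (cutc y) by exact/LpcE.
  split; first by apply/LpcE => //; rewrite E; exact: LpZ.
  by rewrite (lpcnormE p1) E lpnormZ// cabs_real -(lpcnormE p1) ger0_norm ?invr_ge0// mulVf.
by rewrite dualZ// cabsM cabs_real ger0_norm ?invr_ge0// mulrC.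
Qed.

(** This continuity makes E -> a(1_E) countably additive, and later carries the integral formula
    through dominated limits. *)
Lemma dual_dct (y_ : nat -> T -> R[i]) y Y :
  (forall n, cmeasurable (y_ n)) -> cmeasurable y -> Lp p Y ->
  (forall n t, cabs (y_ n t) <= cabs (Y t)) -> (forall t, cabs (y t) <= cabs (Y t)) ->
  (forall t, ccvg (y_ ^~ t) (y t)) -> ccvg (fun n => a (y_ n)) (a y).
Proof.
move=> my_ my LY yY_ yY yy.
have L_ n : Lp p (y_ n) := (le_Lp p1 (my_ n) LY (yY_ n)).1.
have L : Lp p y := (le_Lp p1 my LY yY).1.
apply: (@cvg_dist_le _ _
  (fun n => fine (dualnorm p a) * lpnorm p (fun t => y_ n t - y t))).
- move=> n; rewrite subr0 normr_cabs.
  have -> : a (y_ n) - a y = a (fun t => y_ n t - y t).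
    have := dual_lin (-1) (Lpc_Lp p1 L) (Lpc_Lp p1 (L_ n)).
    rewrite mulN1r addrC => <-.
    by congr a; apply/funext => t; rewrite mulN1r addrC.
  have LB : Lp p (fun t => y_ n t - y t) by exact: LpB.
  apply: le_trans (dual_bound (Lpc_Lp p1 LB)) _.
  by apply: ler_wpM2l; [exact: dualnorm_ge0|exact: lpcnorm_le].
- rewrite -(mulr0 (fine (dualnorm p a))); apply: cvgM; first exact: cvg_cst.
  exact: lpnorm_dct yY_ yY yy.
Qed.

Definition cind (E : set T) : T -> R[i] :=
  fun t => Complex (\1_(E `&` @cube R c) t) 0.

Lemma cmeasurable_cind E : measurable E -> cmeasurable (cind E).
Proof.
move=> mE; apply: cmeasurable_real; apply: measurable_indic.
by apply: measurableI => //; exact: measurable_cube.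
Qed.

Lemma cind_le1 E t : cabs (cind E t) <= 1.
Proof. by rewrite cabs_real indicE; case: (_ \in _); rewrite ?normr1 ?normr0. Qed.

Lemma cind_cut E : cutc (cind E) = cind E.
Proof.
apply: cut_id => t ct; apply: complexP => //=.
by rewrite indicE memNset// => -[].
Qed.

Lemma Lp_cind E : measurable E -> Lp p (cind E).
Proof.
move=> mE; rewrite -cind_cut; apply: Lp_bounded (cind_le1 E) => //.
exact: cmeasurable_cind.
Qed.

Lemma dual_cindU E F : measurable E -> measurable F -> E `&` F = set0 ->
  a (cind (E `|` F)) = a (cind E) + a (cind F).
Proof.
move=> mE mF EF; rewrite -dualD; [|by apply: Lpc_Lp => //; exact: Lp_cind..].
congr a; apply/funext => t; apply: complexP; rewrite ?cReD ?cImD /= ?addr0//.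
rewrite !indicE !in_setI in_setU.
have : (t \in E `&` F) = false by rewrite EF in_set0.
rewrite in_setI; case: (t \in E); case: (t \in F) => //= _; case: (t \in cube (c:=c));
  by rewrite ?addr0 ?add0r.
Qed.

Section charge.
Variable phi : R[i] -> R.
Hypothesis phi0 : phi 0 = 0.
Hypothesis phiD : {morph phi : z w / z + w}.
Hypothesis phi_cvg : forall u l, ccvg u l -> (fun n => phi (u n)) @ \oo --> phi l.

(** [phi] stands for the real or the imaginary part. Radon-Nikodym concerns real charges, so it is
    applied once for each part and the two densities are recombined. *)
Definition dual_charge (E : set T) : \bar R := (phi (a (cind E)))%:E.

Let cind0 : a (cind set0) = 0.
Proof.
rewrite -dual0; congr a; apply/funext => t; apply: complexP => //=.
by rewrite set0I indic0.
Qed.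

Let dual_charge0 : dual_charge set0 = 0%E.
Proof. by rewrite /dual_charge cind0 phi0. Qed.

Let dual_charge_fin : fin_num_fun dual_charge.
Proof. by []. Qed.

Let dual_charge_sigma_additive : semi_sigma_additive dual_charge.
Proof.
move=> F mF tF mUF.
(* By finite additivity the partial sums are values at indicators of finite unions, which increase
   to the indicator of the whole union and are dominated by that of the cube. *)
have E n : (\sum_(0 <= i < n) dual_charge (F i) =
    (phi (a (cind (\big[setU/set0]_(0 <= i < n) F i))))%:E)%E.
  elim: n => [|n IH]; first by rewrite !big_geq// cind0 phi0.
  rewrite !big_nat_recr//= IH dual_cindU ?phiD//; first exact: bigsetU_measurable.
  rewrite big_mkord; apply/eqP; rewrite setIC; apply/negPn/negP => /set0P[t [Ft]].
  rewrite -bigcup_mkord => -[k /= kn Fkt].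
  by move: kn; rewrite (tF n k I I) ?ltnn//; exists t.
rewrite (_ : (fun n => _) = (fun n => (phi (a (cind (\big[setU/set0]_(0 <= i < n) F i))))%:E)).
  apply: cvg_EFin; first exact: nearW.
  apply: phi_cvg; apply: (@dual_dct _ _ (cind setT)).
  - by move=> n; apply: cmeasurable_cind; exact: bigsetU_measurable.
  - exact: cmeasurable_cind.
  - exact: Lp_cind.
  - move=> n t; rewrite !cabs_real setTI !ger0_norm// !indicE ler_nat.
    by rewrite in_setI; case: (t \in \big[setU/set0]_(0 <= i < n) F i).
  - move=> t; rewrite !cabs_real setTI !ger0_norm// !indicE ler_nat.
    by rewrite in_setI; case: (t \in \bigcup_n F n).
  (* Pointwise the sequence is eventually constant: once some [F k] containing t has been included,
     or from the start if there is none. *)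
  - move=> t; rewrite /ccvg.
    have [[k _ Fkt]|nF] := pselect ((\bigcup_n F n) t).
    + apply/cvgrPdist_lt => e e0; exists k.+1 => // n kn.
      rewrite (_ : cind _ t = cind (\bigcup_n F n) t) ?subrr ?cabs0 ?subrr ?normr0//.
      apply: complexP => //=; rewrite !indicE !in_setI; congr ((_ && _)%:R).
      rewrite !mem_set//; first by exists k.
      by rewrite big_mkord -bigcup_mkord; exists k.
    + rewrite (_ : (fun n => _) = cst 0); first exact: cvg_cst.
      apply/funext => n.
      rewrite (_ : cind _ t = cind (\bigcup_n F n) t) ?subrr ?cabs0//.
      apply: complexP => //=; rewrite !indicE !in_setI; congr ((_ && _)%:R).
      rewrite !memNset// big_mkord -bigcup_mkord => -[k _ Fkt].
      by apply: nF; exists k.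
by apply/funext.
Qed.

HB.instance Definition _ := isCharge.Build _ _ _ dual_charge
  dual_charge0 dual_charge_fin dual_charge_sigma_additive.

(** The indicator of a null set equals 0 almost everywhere on the cube, and [a] does not distinguish
    functions that agree almost everywhere there. *)
Lemma dual_charge_dominated : dual_charge `<< mu.
Proof.
apply/null_content_dominatesP => E mE E0.
rewrite /dual_charge (_ : a (cind E) = 0) ?phi0// -dual0.
have [aeq _ _] := da; apply: aeq.
- by apply: Lpc_Lp => //; exact: Lp_cind.
- exact: Lpc0.
- apply/ae_cubeE; exists E; split => // t /= nt; apply: contrapT => Et.
  apply: nt => _; apply: complexP => //=.
  by rewrite indicE memNset// => -[].
Qed.

Lemma dual_density : exists h : T -> R, mu.-integrable setT (EFin \o h) /\
  forall E, measurable E -> phi (a (cind E)) = Rintegral mu E h.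
Proof.
have dom := dual_charge_dominated.
pose f := Radon_Nikodym dual_charge mu.
have ff t : f t \is a fin_num by exact: Radon_Nikodym_fin_num.
have fE : EFin \o (fun t => fine (f t)) = f.
  by apply/funext => t /=; rewrite fineK.
exists (fun t => fine (f t)); split; first by rewrite fE; exact: Radon_Nikodym_integrable.
move=> E mE; apply: EFin_inj; rewrite -/(dual_charge E) (Radon_Nikodym_integral dom mE).
rewrite /Rintegral fineK.
  by apply: eq_integral => t _; rewrite fineK.
rewrite -/(comp _ _) integrable_fin_num//.
rewrite (_ : (fun x => _) = f).
  by apply: integrableS (Radon_Nikodym_integrable dom).
exact: fE.
Qed.

End charge.

End riesz.

Lemma cvg_eventually (R : realType) (u : nat -> R) (l : R) (N : nat) :
  (forall n, (N <= n)%N -> u n = l) -> u @ \oo --> l.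
Proof.
move=> ul; apply/cvgrPdist_lt => e e0; exists N => // n Nn.
by rewrite ul// subrr normr0.
Qed.

Lemma bound_le (R : realType) (x : R) (n : nat) :
  (Num.bound x <= n)%N -> x <= n%:R.
Proof.
by move=> bn; rewrite (le_trans (ltW (unstable.ltr_bound x)))// ler_nat.
Qed.

Import HBNNSimple.

(** * Integral representation of bounded functionals *)

Section riesz_representation.
Context (R : realType) (c : nat) (p : R).
Hypothesis p1 : 1 <= p.
Local Notation T := (c.-tuple R).
Local Notation mu := (lebn R c).
Implicit Types y z : T -> R[i].
Variable a : (T -> R[i]) -> R[i].
Hypothesis da : dual_elt p a.

Lemma dual_complex_density : exists H : T -> R[i],
  [/\ Cintegrable mu H, forall t, ~ cube t -> H t = 0 &
      forall E, measurable E -> a (cind E) = Cint mu (fun t => H t * cind E t)].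
Proof.
have [h1 [I1 h1E]] := dual_density p1 da (erefl (complex.Re (0 : R[i]))) (@cReD R) (@ccvg_Re R).
have [h2 [I2 h2E]] := dual_density p1 da (erefl (complex.Im (0 : R[i]))) (@cImD R) (@ccvg_Im R).
have m1 : measurable_fun setT h1 by apply/measurable_EFinP; case/integrableP : I1.
have m2 : measurable_fun setT h2 by apply/measurable_EFinP; case/integrableP : I2.
exists (cutc (fun t : T => Complex (h1 t) (h2 t))); split.
- have J1 := integrable_abse I1; have J2 := integrable_abse I2.
  have J := integrableD measurableT J1 J2.
  apply: (le_Cintegrable _ (measurable_int _ J)).
  + by apply: cmeasurable_cut; split.
  + exact: (integrable_lty measurableT J).
  + move=> t; rewrite /= -EFinD lee_fin (le_trans (cabs_cut_le _ _))//.
    exact: cabs_le_ReIm.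
- by move=> t; exact: cut0.
- move=> E mE; have mEc : measurable (E `&` @cube R c).
    by apply: measurableI => //; exact: measurable_cube.
  (* The charge sees only the part of E in the cube, so the density may be integrated over that
     part, where cutting it to the cube changes nothing. *)
  have cE : cind (E `&` cube (c:=c)) = cind E :> (T -> R[i]).
    by apply/funext => t; rewrite /cind -setIA setIid.
  apply: complexP => /=.
  + rewrite -cE h1E// Rintegral_mkcond patch_indic; apply: eq_Rintegral => t _ /=.
    rewrite cReM cE /= mulr0 subr0 /cutc indicE; case: asboolP => // ct.
    by rewrite memNset ?mulr0// => -[].
  + rewrite -cE h2E// Rintegral_mkcond patch_indic; apply: eq_Rintegral => t _ /=.
    rewrite cImM cE /= mulr0 add0r /cutc indicE; case: asboolP => // ct.
    by rewrite memNset ?mulr0// => -[].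
Qed.

Section density.
Variable H : T -> R[i].
Hypothesis IH : Cintegrable mu H.
Hypothesis H0 : forall t, ~ cube t -> H t = 0.
Hypothesis HE : forall E, measurable E -> a (cind E) = Cint mu (fun t => H t * cind E t).

Let mH : cmeasurable H. Proof. exact: IH.1. Qed.

(** The class of functions on which [a] is integration against [H]. It is enlarged in stages:
    indicators, bounded nonnegative functions, bounded complex functions, and finally all of L_p of
    the cube. The last stage rests on [riesz_bound], which is itself proved by testing on bounded
    functions. *)
Definition represented y := [/\ Lp p y, Cintegrable mu (fun t => H t * y t) &
  a y = Cint mu (fun t => H t * y t)].

Lemma represented_lin l y z : represented y -> represented z ->
  represented (fun t => l * y t + z t).
Proof.
move=> [Ly Iy ay] [Lz Iz az].
have E : (fun t => H t * (l * y t + z t)) = (fun t => l * (H t * y t) + H t * z t).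
  by apply/funext => t; rewrite mulrDr mulrCA.
have IlH := CintegrableZ l Iy.
split.
- by apply: LpD => //; exact: LpZ.
- by rewrite E; exact: CintegrableD.
- rewrite (dual_lin da l (Lpc_Lp p1 Ly) (Lpc_Lp p1 Lz)) E CintD//.
  by rewrite CintZ// ay az.
Qed.

Lemma represented0 : represented (fun=> 0).
Proof.
split; first exact: Lp0.
- by under eq_fun do rewrite mulr0; exact: Cintegrable0.
- rewrite (dual0 p1 da); under eq_Cint do rewrite mulr0.
  by rewrite Cint0.
Qed.

Lemma represented_sum (I : Type) (s : seq I) (l : I -> R[i]) (F : I -> T -> R[i]) :
  (forall i, represented (F i)) -> represented (fun t => \sum_(i <- s) l i * F i t).
Proof.
move=> rF; elim: s => [|i s IHs].
  by under eq_fun do rewrite big_nil; exact: represented0.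
by under eq_fun do rewrite big_cons; exact: represented_lin.
Qed.

(** There are two dominations: Y in L_p lets [a] pass to the limit, and integrability of |H||Y| lets
    the integral do so. As long as H is only known to be in L_1, the second is available for
    constants on the cube. *)
Lemma represented_dct (y_ : nat -> T -> R[i]) y Y :
  (forall n, represented (y_ n)) -> cmeasurable y -> Lp p Y ->
  (\int[mu]_t (cabs (H t) * cabs (Y t))%:E < +oo)%E ->
  (forall n t, cabs (y_ n t) <= cabs (Y t)) -> (forall t, cabs (y t) <= cabs (Y t)) ->
  (forall t, ccvg (y_ ^~ t) (y t)) -> represented y.
Proof.
move=> ry my LY HY yY_ yY yy.
have my_ n : cmeasurable (y_ n) by have [/LpE[]] := ry n.
have [mY _] := (LpE _ _).1 LY.
have cv1 := dual_dct p1 da my_ my LY yY_ yY yy.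
have [|||||Iy cv2] := @Cint_dct _ _ _ mu (fun n t => H t * y_ n t) (fun t => H t * y t)
  (fun t => (cabs (H t) * cabs (Y t))%:E) _ _ _ _ HY.
- by move=> n; exact: cmeasurableM.
- exact: cmeasurableM.
- by apply: nearW => t; exact: ccvgZ.
- by apply/measurable_EFinP; apply: measurable_funM; exact: cmeasurable_cabs.
- by move=> n t; rewrite lee_fin cabsM ler_wpM2l ?cabs_ge0.
split => //; first exact: (le_Lp p1 my LY yY).1.
apply: (ccvg_unique cv1); rewrite (_ : (fun n => _) = (fun n => Cint mu (fun t => H t * y_ n t)))//.
by apply/funext => n; have [] := ry n.
Qed.

Lemma represented_cind E : measurable E -> represented (cind E).
Proof.
move=> mE; split; [exact: Lp_cind| |exact: HE].
apply: (@le_Cintegrable _ _ _ mu _ (fun t => (cabs (H t))%:E)).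
- by apply: cmeasurableM => //; exact: cmeasurable_cind.
- exact: measurable_ecabs.
- exact: IH.2.
- by move=> t; rewrite lee_fin cabsM ler_piMr ?cabs_ge0 ?cind_le1.
Qed.

Lemma integrable_cube_cst (K : R) :
  (\int[mu]_t (cabs (H t) * cabs (cutc (fun=> Complex K 0) t))%:E < +oo)%E.
Proof.
apply: (@le_lt_trans _ _ (\int[mu]_t (`|K|%:E * (cabs (H t))%:E))%E).
  apply: ge0_le_integral => //.
  - by move=> t _; rewrite lee_fin mulr_ge0 ?cabs_ge0.
  - apply/measurable_EFinP; apply: measurable_funM; apply: cmeasurable_cabs => //.
    by apply: cmeasurable_cut; exact: cmeasurable_cst.
  - by apply: measurable_funeM; exact: measurable_ecabs.
  - move=> t _; rewrite -EFinM lee_fin mulrC ler_wpM2r ?cabs_ge0//.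
    by rewrite (le_trans (cabs_cut_le _ _))// cabs_real.
rewrite ge0_integralZl_EFin//.
- by rewrite lte_mul_pinfty ?lee_fin//; exact: IH.2.
- by move=> t _; rewrite lee_fin cabs_ge0.
- exact: measurable_ecabs.
Qed.

Lemma represented_nneg (f : T -> R) (M : R) : measurable_fun setT f ->
  (forall t, 0 <= f t <= M) -> represented (cutc (fun t => Complex (f t) 0)).
Proof.
move=> mf fM.
have mEf : measurable_fun setT (EFin \o f) by exact/measurable_EFinP.
pose f_ n := nnsfun_approx measurableT mEf n.
have f_f t : (fun n => f_ n t) @ \oo --> f t.
  have H1 : (EFin \o (fun n => f_ n t)) @ \oo --> (f t)%:E.
    apply: (@cvg_nnsfun_approx _ _ _ _ measurableT _ mEf _ t I) => s _.
    by rewrite lee_fin; case/andP : (fM s).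
  exact: (fine_cvg H1).
have f_le n t : f_ n t <= f t.
  rewrite -(cvg_lim _ (f_f t))//; apply: (@nondecreasing_cvgn_le _ (fun n => f_ n t)).
  - move=> m k mk; have := nd_nnsfun_approx measurableT mEf mk.
    by move=> /lefP.
  - by apply/cvg_ex; exists (f t); exact: f_f.
have f_0 n t : 0 <= f_ n t by [].
apply: (@represented_dct (fun n => cutc (fun t => Complex (f_ n t) 0)) _ (cutc (fun=> Complex M 0))).
- move=> n.
  (* A simple function takes finitely many values, so it is a linear combination of the indicators
     of its level sets. *)
  rewrite (_ : cutc _ = (fun t => \sum_(i < size (finmap.enum_fset (fset_set (range (f_ n)))))
     Complex ((finmap.enum_fset (fset_set (range (f_ n))))`_i) 0 *
     cind (f_ n @^-1` [set (finmap.enum_fset (fset_set (range (f_ n))))`_i]) t)).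
    by apply: represented_sum => i; apply: represented_cind; exact: measurable_sfunP.
  apply/funext => t; rewrite /cutc; case: asboolP => ct.
    rewrite [in LHS]fimfunEord -[LHS]/(real_complex R _) rmorph_sum /=.
    apply: eq_bigr => i _; apply: complexP; rewrite ?cReM ?cImM /= ?mulr0 ?mul0r ?subr0 ?addr0//.
    by congr (_ * _); rewrite !indicE in_setI [X in _ && X]mem_set// andbT.
  rewrite big1// => i _; apply: complexP; rewrite ?cReM ?cImM /= ?mulr0 ?mul0r ?subr0 ?addr0//.
  by rewrite indicE memNset ?mulr0// => -[].
- apply: cmeasurable_cut; exact: cmeasurable_real.
- exact: Lp_cube_cst.
- exact: integrable_cube_cst.
- move=> n t; rewrite /cutc; case: asboolP => // _; rewrite !cabs_real !ger0_norm//.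
    by rewrite (le_trans (f_le n t))//; case/andP : (fM t).
  by case/andP : (fM t) => /le_trans; exact.
- move=> t; rewrite /cutc; case: asboolP => // _; rewrite !cabs_real !ger0_norm//.
  + by case/andP : (fM t).
  + by case/andP : (fM t) => /le_trans; exact.
  + by case/andP : (fM t).
- move=> t; rewrite /cutc; case: asboolP => // _; last exact: ccvg_cst.
  by apply: ccvg_ReIm => /=; [exact: f_f|exact: cvg_cst].
Qed.

Lemma represented_bounded y (M : R) : cmeasurable y -> (forall t, cabs (y t) <= M) ->
  represented (cutc y).
Proof.
move=> [m1 m2] yM.
have real (f : T -> R) : measurable_fun setT f -> (forall t, `|f t| <= M) ->
    represented (cutc (fun t => Complex (f t) 0)).
  move=> mf fM.
  (* f + M has values in [0, 2M], so the nonnegative case applies; the constant M is subtracted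
     afterwards. *)
  have r1 : represented (cutc (fun t => Complex (f t + M) 0)).
    apply: (@represented_nneg _ (M + M)); first exact: measurable_funD.
    move=> t; have := fM t; rewrite ler_norml => /andP[? ?].
    by apply/andP; split; lra.
  have r2 : represented (cutc (fun t => Complex `|M| 0)).
    apply: (@represented_nneg _ `|M|); first exact: measurable_cst.
    by move=> t; rewrite normr_ge0 lexx.
  have M0 (t : T) : 0 <= M by exact: le_trans (fM t).
  have := represented_lin (-1) r2 r1; congr represented; apply/funext => t.
  rewrite /cutc; case: asboolP => // _; last by rewrite mulr0 addr0.
  apply: complexP; rewrite mulN1r ?cReD ?cImD /= ?oppr0 ?addr0//.
  by rewrite ger0_norm ?(M0 t)// addrC addrK.
have r1 : represented (cutc (fun t => Complex (complex.Re (y t)) 0)).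
  by apply: real => // t; exact: le_trans (Re_le_cabs _) (yM t).
have r2 : represented (cutc (fun t => Complex (complex.Im (y t)) 0)).
  by apply: real => // t; exact: le_trans (Im_le_cabs _) (yM t).
have := represented_lin (Complex 0 1) r2 r1; congr represented; apply/funext => t.
rewrite /cutc; case: asboolP => // _; last by rewrite mulr0 addr0.
by apply: complexP; rewrite ?cReD ?cImD ?cReM ?cImM /=; lra.
Qed.

(* Testing [a] on min(|y|, n) times the conjugate phase of H. *)
Lemma riesz_bound y : Lp p y -> (forall t, ~ cube t -> y t = 0) ->
  (\int[mu]_t (cabs (H t) * cabs (y t))%:E <= (fine (dualnorm p a) * lpnorm p y)%:E)%E.
Proof.
move=> Ly y0; have [my _] := (LpE _ _).1 Ly.
(* This is conj(H)/|H|. Where H = 0 the convention that 0 has inverse 0 makes the phase 0, and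
   [Hphase] still holds. *)
pose phase t := Complex (complex.Re (H t) / cabs (H t)) (- complex.Im (H t) / cabs (H t)).
have Hphase t : H t * phase t = Complex (cabs (H t)) 0.
  have [E|n0] := eqVneq (cabs (H t)) 0.
    by rewrite (cabs_eq0 E) mul0r cabs0.
  have sq : cabs (H t) ^+ 2 = complex.Re (H t) ^+ 2 + complex.Im (H t) ^+ 2.
    by case: (H t) => u v; rewrite /cabs /= sqr_sqrtr// addr_ge0// sqr_ge0.
  apply: complexP; rewrite ?cReM ?cImM /=.
  - rewrite !mulrA -mulrBl mulrN opprK -!expr2 -sq expr2 mulfK//.
  - rewrite !mulrA -mulrDl mulrN addrC [X in X - _]mulrC subrr mul0r//.
have phase1 t : cabs (phase t) <= 1.
  have [E|n0] := eqVneq (cabs (H t)) 0.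
    by rewrite /phase E invr0 !mulr0 cabs_real normr0 ler01.
  have := congr1 (@cabs R) (Hphase t); rewrite cabsM cabs_real normr_cabs => E.
  have Hp : 0 < cabs (H t) by rewrite lt0r n0 cabs_ge0.
  by rewrite -(ler_pM2l Hp) E mulr1.
have mphase : cmeasurable phase.
  have mV : measurable_fun setT (fun t => (cabs (H t))^-1).
    under eq_fun do rewrite -powR_inv1 ?cabs_ge0//.
    exact: (measurableT_comp (measurable_powR (-1)) (cmeasurable_cabs mH)).
  have [mH1 mH2] := mH.
  split => /=; apply: measurable_funM => //.
  exact: measurableT_comp.
(* Truncation at n makes the test function bounded, hence already represented; n tends to infinity
   by Fatou. *)
pose y_ n t := Complex (Num.min (cabs (y t)) n%:R) 0 * phase t.
have my_ n : cmeasurable (y_ n).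
  apply: cmeasurableM => //; apply: cmeasurable_real.
  by apply: measurable_minr; [exact: cmeasurable_cabs|exact: measurable_cst].
have min0 n t : 0 <= Num.min (cabs (y t)) n%:R by rewrite le_min cabs_ge0/=.
have y_1 n t : cabs (y_ n t) <= Num.min (cabs (y t)) n%:R.
  by rewrite cabsM cabs_real ger0_norm// ler_piMr.
have r_ n : represented (cutc (y_ n)).
  apply: (@represented_bounded _ n%:R) => // t.
  by rewrite (le_trans (y_1 n t))// ge_min lexx orbT.
pose g n t := cabs (H t) * Num.min (cabs (y t)) n%:R.
have gE n : (fun t => H t * cutc (y_ n) t) = (fun t => Complex (g n t) 0).
  apply/funext => t; have [ct|ct] := pselect (cube t).
    rewrite cutE// mulrCA Hphase; apply: complexP; rewrite ?cReM ?cImM /=.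
      by rewrite mulr0 subr0 mulrC.
    by rewrite mulr0 mul0r addr0.
  by rewrite cut0// mulr0 /g H0// cabs0 mul0r.
have mg n : measurable_fun setT (g n).
  apply: measurable_funM; first exact: cmeasurable_cabs.
  by apply: measurable_minr; [exact: cmeasurable_cabs|exact: measurable_cst].
have g0 n t : 0 <= g n t by rewrite mulr_ge0 ?cabs_ge0.
apply: (@fatou_le _ _ _ mu (fun n t => (g n t)%:E)).
- by move=> n; exact/measurable_EFinP.
- by move=> n t; rewrite lee_fin.
- by apply/measurable_EFinP; apply: measurable_funM; exact: cmeasurable_cabs.
- by move=> t; rewrite lee_fin mulr_ge0 ?cabs_ge0.
- move=> t; have cv : (fun n => (g n t)%:E) @ \oo --> (cabs (H t) * cabs (y t))%:E.
    apply: cvg_EFin; first exact: nearW.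
    apply: (@cvg_eventually _ _ _ (Num.bound (cabs (y t)))) => n bn.
    by rewrite /comp /fine /g min_l//; exact: bound_le bn.
  by rewrite (cvg_limn_einf_sup cv).1.
- move=> n; have [Ln In an] := r_ n.
  (* On the cube [H] times the test function is the real function [g n], so its integral is the real
     part of [a] at the test function, and the dual norm bounds it. *)
  have -> : (\int[mu]_t (g n t)%:E)%E = (complex.Re (a (cutc (y_ n))))%:E.
    rewrite an gE /= /Rintegral fineK// integrable_fin_num//.
    move: In; rewrite gE => /integrable_Re; exact.
  rewrite lee_fin (le_trans (ler_norm _))// (le_trans (Re_le_cabs _))//.
  rewrite (le_trans (dual_bound p1 da (Lpc_Lp p1 Ln)))//.
  apply: ler_wpM2l; first exact: dualnorm_ge0.
  apply: (le_trans (lpcnorm_le p1 Ln)).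
  apply: (le_Lp p1 ((LpE _ _).1 Ln).1 Ly _).2 => t.
  rewrite (le_trans (cabs_cut_le _ _))// (le_trans (y_1 n t))//.
  by rewrite ge_min lexx.
Qed.

Lemma represented_Lp y : Lp p y -> (forall t, ~ cube t -> y t = 0) -> represented y.
Proof.
move=> Ly y0; have [my _] := (LpE _ _).1 Ly.
(* Cutting y to the set where |y| <= n gives bounded functions that tend to y and are dominated by
   y; |H||y| is integrable by [riesz_bound]. *)
pose D n : set T := [set t | cabs (y t) <= n%:R].
have mD n : measurable (D n).
  rewrite (_ : D n = (fun t => cabs (y t)) @^-1` `]-oo, n%:R]%classic).
    by rewrite -[X in measurable X]setTI; apply: cmeasurable_cabs.
  by apply/seteqP; split => t /=; rewrite in_itv.
pose y_ n t := if `[< D n t >] then y t else 0.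
have y_le n t : cabs (y_ n t) <= cabs (y t).
  by rewrite /y_; case: asboolP => // _; rewrite cabs0 cabs_ge0.
apply: (@represented_dct y_ _ y) => //.
- move=> n; have -> : y_ n = cutc (y_ n).
    by rewrite cut_id// => t ct; rewrite /y_ y0// if_same.
  apply: (@represented_bounded _ n%:R).
    by apply: cmeasurable_if => //; exact: cmeasurable_cst.
  by move=> t; rewrite /y_; case: asboolP => // _; rewrite cabs0.
- exact: le_lt_trans (riesz_bound Ly y0) (ltry _).
- move=> t; apply: (@cvg_eventually _ _ _ (Num.bound (cabs (y t)))) => n bn.
  rewrite /y_ asboolT ?subrr ?cabs0//.
  exact: bound_le bn.
Qed.

End density.

Lemma riesz : exists H : T -> R[i],
  [/\ cmeasurable H, forall t, ~ cube t -> H t = 0 &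
   forall y, Lpc p y ->
    (\int[mu]_t (cabs (H t) * cabs (y t))%:E <=
      (fine (dualnorm p a) * lpcnorm p y)%:E)%E /\
    a y = Cint mu (fun t => H t * y t)].
Proof.
have [H [IH H0 HE]] := dual_complex_density.
exists H; split => //; first exact: IH.1.
move=> y Ly; have Lcy : Lp p (cutc y) by exact/LpcE.
have E t : H t * y t = H t * cutc y t.
  by have [ct|ct] := pselect (cube t); [rewrite cutE|rewrite H0// !mul0r].
have E' t : cabs (H t) * cabs (y t) = cabs (H t) * cabs (cutc y t).
  by rewrite -!cabsM E.
split.
  under eq_integral do rewrite E'.
  by rewrite (lpcnormE p1); apply: (riesz_bound IH H0 HE Lcy) => t; exact: cut0.
have [|_ _] := represented_Lp IH H0 HE Lcy; first by move=> t; exact: cut0.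
by rewrite (dual_cut p1 da Ly) => ->; apply: eq_Cint => t; rewrite E.
Qed.

End riesz_representation.

Lemma ae_lty (R : realType) (d : measure_display) (T : measurableType d)
    (mu : {measure set T -> \bar R}) (f : T -> \bar R) :
  measurable_fun setT f -> (forall t, 0 <= f t)%E -> (\int[mu]_t f t < +oo)%E ->
  {ae mu, forall t, (f t < +oo)%E}.
Proof.
move=> mf f0 foo.
have If : mu.-integrable setT f.
  by apply/integrableP; split => //; under eq_integral do rewrite gee0_abs//.
by apply: filterS (integrable_ae measurableT If) => t /(_ I); rewrite ge0_fin_numE.
Qed.

(** * Kernels of nuclear operators *)

Section complex_series.
Variable R : realType.
Implicit Types w : nat -> R[i].

(* [fine] and [limn_esup] make the sum total, hence jointly measurable in any
   parameter, without a convergence hypothesis. *)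
Definition csum w : R[i] :=
  Complex (fine (limn_esup (fun N => (complex.Re (\sum_(i < N) w i))%:E)))
          (fine (limn_esup (fun N => (complex.Im (\sum_(i < N) w i))%:E))).

Lemma ccvg_csum w : (\sum_(0 <= i <oo) (cabs (w i))%:E < +oo)%E ->
  ccvg (fun N => \sum_(i < N) w i) (csum w).
Proof.
move=> woo.
have w0 i : (0 <= (cabs (w i))%:E)%E by rewrite lee_fin cabs_ge0.
have cabsw : cvgn (series (fun i => cabs (w i))).
  apply: nondecreasing_is_cvgn.
    by apply: nondecreasing_series => i _ _; exact: cabs_ge0.
  exists (fine (\sum_(0 <= i <oo) (cabs (w i))%:E)%E) => _ [n _ <-].
  rewrite -lee_fin fineK; last by rewrite ge0_fin_numE// nneseries_ge0.
  by rewrite /series -sumEFin; exact: nneseries_lim_ge.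
have real (r : nat -> R) : (forall i, `|r i| <= cabs (w i)) -> cvgn (series r).
  move=> rw; apply: normed_cvg; apply: series_le_cvg rw cabsw => i //.
  exact: cabs_ge0.
have conv (r : nat -> R) : (forall i, `|r i| <= cabs (w i)) ->
    (fun N => \sum_(i < N) r i) @ \oo --> fine (limn_esup (fun N => (\sum_(i < N) r i)%:E)).
  move=> /real cr.
  have cl : (fun N => \sum_(i < N) r i) @ \oo --> limn (series r).
    rewrite (_ : (fun N => _) = series r)//.
    by apply/funext => N; rewrite /series /= big_mkord.
  have /cvg_limn_einf_sup[_ ->//] : (fun N => (\sum_(i < N) r i)%:E) @ \oo --> (limn (series r))%:E.
  by apply: cvg_EFin; [exact: nearW|exact: cl].
apply: ccvg_ReIm.
- rewrite /=; under eq_fun do rewrite (raddf_sum (@complex.Re R)).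
  under [X in limn_esup X]eq_fun do rewrite (raddf_sum (@complex.Re R)).
  exact: (conv (fun i => complex.Re (w i)) (fun i => Re_le_cabs (w i))).
- rewrite /=; under eq_fun do rewrite (raddf_sum (@complex.Im R)).
  under [X in limn_esup X]eq_fun do rewrite (raddf_sum (@complex.Im R)).
  exact: (conv (fun i => complex.Im (w i)) (fun i => Im_le_cabs (w i))).
Qed.

Lemma cabs_partial_sum_le w N :
  ((cabs (\sum_(i < N) w i))%:E <= \sum_(0 <= i <oo) (cabs (w i))%:E)%E.
Proof.
apply: (@le_trans _ _ (\sum_(0 <= i < N) (cabs (w i))%:E)%E).
  by rewrite sumEFin lee_fin big_mkord cabs_sum.
by apply: nneseries_lim_ge => i _ _; rewrite lee_fin cabs_ge0.
Qed.

(** When the series of moduli diverges the right side is +oo. The bound therefore holds at every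
    point, and the kernel estimates built on it are free of exceptional sets. *)
Lemma cabs_csum_le w : ((cabs (csum w))%:E <= \sum_(0 <= i <oo) (cabs (w i))%:E)%E.
Proof.
have [woo|] := ltP (\sum_(0 <= i <oo) (cabs (w i))%:E)%E +oo%E; last first.
  by rewrite leye_eq => /eqP ->; rewrite leey.
have sfin : (\sum_(0 <= i <oo) (cabs (w i))%:E)%E \is a fin_num.
  by rewrite ge0_fin_numE// nneseries_ge0// => i _ _; rewrite lee_fin cabs_ge0.
have := @ccvg_cabsB R 0 _ _ (ccvg_csum woo); rewrite sub0r cabsN => cv.
rewrite -(fineK sfin) lee_fin; apply: (cvgr_to_le cv); apply: nearW => N.
by rewrite sub0r cabsN -lee_fin fineK//; exact: cabs_partial_sum_le.
Qed.

Lemma cmeasurable_csum (d : measure_display) (T : measurableType d)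
    (w : nat -> T -> R[i]) : (forall i, cmeasurable (w i)) ->
  cmeasurable (fun t => csum (w ^~ t)).
Proof.
move=> mw; split => /=.
- apply: (measurableT_comp (fine_measurable measurableT)).
  apply: measurable_fun_limn_esup => N; apply/measurable_EFinP.
  exact: (cmeasurable_sum (index_enum 'I_N) (fun i => mw i)).1.
- apply: (measurableT_comp (fine_measurable measurableT)).
  apply: measurable_fun_limn_esup => N; apply/measurable_EFinP.
  exact: (cmeasurable_sum (index_enum 'I_N) (fun i => mw i)).2.
Qed.

End complex_series.

Section nuclear_kernel.
Context (R : realType) (c : nat) (p : R).
Hypothesis p1 : 1 <= p.
Local Notation T := (c.-tuple R).
Local Notation mu := (lebn R c).
Implicit Types y z : T -> R[i].

(** The estimate separates the variables: [riesz] bounds the integral in s by ||a_i|| ||y||, and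
    [L1_le_lpnorm] bounds the integral in t by 2 ||y_i||. Its finiteness allows integrating the
    series term by term for almost every t. The kernel is fixed before y; only the null set depends
    on y. *)
Lemma nuclear_kernel b a ys : nuclear_rep p b a ys ->
  exists n : T * T -> R[i],
  [/\ cmeasurable n, forall t s, ~ cube s -> n (t, s) = 0 &
   forall y, Lp p y ->
    (\int[mu]_t \int[mu]_s (cabs (n (t, s)) * cabs (y s))%:E <=
      (2 * lpnorm p y)%:E *
        \sum_(0 <= i <oo) (dualnorm p (a i) * (lpcnorm p (ys i))%:E))%E /\
    {ae mu, forall t, cube t -> b y t = Cint mu (fun s => n (t, s) * y s)}].
Proof.
move=> [da Lys soo Lb bE].
have /choice[v vP] : forall i, exists H : T -> R[i],
    [/\ cmeasurable H, forall t, ~ cube t -> H t = 0 &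
     forall y, Lpc p y ->
      (\int[mu]_t (cabs (H t) * cabs (y t))%:E <=
        (fine (dualnorm p (a i)) * lpcnorm p y)%:E)%E /\
      a i y = Cint mu (fun t => H t * y t)].
  by move=> i; exact: (riesz p1 (da i)).
pose u i := cutc (ys i).
have Lu i : Lp p (u i) by exact/LpcE.
have mu_ i : cmeasurable (u i) by case: ((LpE _ _).1 (Lu i)).
have mv i : cmeasurable (v i) by case: (vP i).
pose w i (ts : T * T) := u i ts.1 * v i ts.2.
have mw i : cmeasurable (w i).
  by apply: cmeasurableM; [exact: (cmeasurable_comp (mu_ i))|exact: (cmeasurable_comp (mv i))].
pose n ts := csum (w ^~ ts).
have mn : cmeasurable n by exact: cmeasurable_csum.
have csum0 (z : nat -> R[i]) : (forall i, z i = 0) -> csum z = 0.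
  move=> z0; apply: cabs_eq0; apply/eqP; rewrite eq_le cabs_ge0 andbT -lee_fin.
  apply: le_trans (cabs_csum_le _) _; rewrite eseries0// => i _ _.
  by rewrite z0 cabs0.
exists n; split => //.
- move=> t s cs; apply: csum0 => i; rewrite /w /=.
  by have [_ -> //] := vP i; rewrite mulr0.
move=> y Ly; have [my _] := (LpE _ _).1 Ly.
have Lcy : Lpc p y by exact: Lpc_Lp.
pose alpha i := (\int[mu]_s (cabs (v i s) * cabs (y s))%:E)%E.
have alpha_le i : (alpha i <= (fine (dualnorm p (a i)) * lpnorm p y)%:E)%E.
  have [_ _ /(_ y Lcy)[+ _]] := vP i; move=> /le_trans; apply.
  by rewrite lee_fin ler_wpM2l ?lpcnorm_le//; exact: dualnorm_ge0.
have alpha0 i : (0 <= alpha i)%E.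
  by apply: integral_ge0 => s _; rewrite lee_fin mulr_ge0 ?cabs_ge0.
pose k i t s := (cabs (w i (t, s)) * cabs (y s))%:E.
have k0 i t s : (0 <= k i t s)%E by rewrite lee_fin mulr_ge0 ?cabs_ge0.
have mk i t : measurable_fun setT (k i t).
  apply/measurable_EFinP; apply: measurable_funM; apply: cmeasurable_cabs => //.
  exact: (cmeasurableZ (u i t) (mv i)).
pose K t s := (\sum_(0 <= i <oo) k i t s)%E.
have K0 t s : (0 <= K t s)%E by exact: nneseries_ge0.
have mK t : measurable_fun setT (K t) by exact: ge0_emeasurable_sum.
(* The integral in s of the series of moduli [K t]. Where it is finite, [K t] serves as dominating
   function in s. *)
pose B t := (\sum_(0 <= i <oo) ((cabs (u i t))%:E * alpha i))%E.
have BE t : (\int[mu]_s K t s = B t)%E.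
  rewrite integral_nneseries//; apply: eq_eseriesr => i _.
  rewrite -ge0_integralZl_EFin ?cabs_ge0//.
  - by apply: eq_integral => s _; rewrite /k /w cabsM -EFinM mulrA.
  - by move=> s _; rewrite lee_fin mulr_ge0 ?cabs_ge0.
  - by apply/measurable_EFinP; apply: measurable_funM; exact: cmeasurable_cabs.
have uB0 i t : (0 <= (cabs (u i t))%:E * alpha i)%E.
  by rewrite mule_ge0// lee_fin cabs_ge0.
have B0 t : (0 <= B t)%E by exact: nneseries_ge0.
have muB i : measurable_fun setT (fun t => (cabs (u i t))%:E * alpha i)%E.
  under eq_fun do rewrite muleC.
  by apply: measurable_funeM; exact: measurable_ecabs.
have mB : measurable_fun setT B by exact: ge0_emeasurable_sum.
have Bint : (\int[mu]_t B t <= (2 * lpnorm p y)%:E *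
    \sum_(0 <= i <oo) (dualnorm p (a i) * (lpcnorm p (ys i))%:E))%E.
  rewrite integral_nneseries// -nneseriesZl; last first.
    move=> i _; rewrite mule_ge0 ?lee_fin ?(lpcnormE p1) ?lpnorm_ge0//.
    by rewrite -(fineK (dualnorm_fin_num p1 (da i))) lee_fin; exact: dualnorm_ge0.
  apply: lee_nneseries => [i _ _|i _]; first exact: integral_ge0.
  under eq_integral do rewrite muleC.
  have afin : alpha i \is a fin_num.
    by rewrite ge0_fin_numE// (le_lt_trans (alpha_le i))// ltry.
  rewrite -(fineK afin) ge0_integralZl_EFin.
  - apply: (@le_trans _ _ ((fine (alpha i))%:E * (2 * lpnorm p (u i))%:E)%E).
      apply: lee_wpmul2l; first by rewrite lee_fin fine_ge0.
      by apply: L1_le_lpnorm => // t; exact: cut0.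
    rewrite -(fineK (dualnorm_fin_num p1 (da i))) -!EFinM lee_fin (lpcnormE p1).
    have : fine (alpha i) <= fine (dualnorm p (a i)) * lpnorm p y.
      by rewrite -lee_fin fineK.
    move=> /(ler_wpM2r (_ : 0 <= 2 * lpnorm p (u i))) => /(_ _)/le_trans; apply.
      by rewrite mulr_ge0// lpnorm_ge0.
    rewrite /u; set x1 := fine _; set x2 := lpnorm _ y; set x3 := lpnorm _ _.
    by rewrite le_eqVlt; apply/orP; left; apply/eqP; lra.
  - exact: measurableT.
  - by move=> t _; rewrite lee_fin cabs_ge0.
  - exact: measurable_ecabs.
  - by rewrite fine_ge0.
have nK t s : ((cabs (n (t, s)) * cabs (y s))%:E <= K t s)%E.
  rewrite /K /k; under eq_eseriesr do rewrite mulrC EFinM.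
  rewrite nneseriesZl; last by move=> i _; rewrite lee_fin cabs_ge0.
  rewrite mulrC EFinM lee_wpmul2l ?lee_fin ?cabs_ge0//.
  exact: cabs_csum_le.
have Boo : (\int[mu]_t B t < +oo)%E.
  apply: le_lt_trans Bint _; rewrite lte_mul_pinfty// lee_fin.
  by rewrite mulr_ge0// lpnorm_ge0.
split.
  apply: le_trans Bint; apply: ge0_le_integral => //.
  - by move=> t _; apply: integral_ge0 => s _; rewrite lee_fin mulr_ge0 ?cabs_ge0.
  - apply: (@measurable_fun_fubini_tonelli_F _ _ _ _ _ mu
      (fun ts : T * T => (cabs (n ts) * cabs (y ts.2))%:E)).
      apply/measurable_EFinP; apply: measurable_funM; apply: cmeasurable_cabs => //.
      exact: (cmeasurable_comp my).
    by move=> ts; rewrite lee_fin mulr_ge0 ?cabs_ge0.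
  - move=> t _; rewrite -BE; apply: ge0_le_integral => //.
    + by move=> s _; rewrite lee_fin mulr_ge0 ?cabs_ge0.
    + apply/measurable_EFinP; apply: measurable_funM; apply: cmeasurable_cabs => //.
      exact: (cmeasurable_comp mn (measurable_pair1 _)).
have aeB := ae_lty mB B0 Boo.
(* The partial sums tend to [b y] in L_p of the cube by nuclearity and to the integral at almost
   every t, so the two limits coincide almost everywhere. *)
have : {ae mu, forall t, cutc (b y) t = Cint mu (fun s => n (t, s) * y s)}.
  apply: (@Lp_ae_lim _ _ _ p1 _ _ (fun N t => \sum_(i < N) a i y * u i t)).
  - move=> N; apply: LpB => //; first by apply/LpcE => //; exact: Lb.
    by apply: Lp_sum => // i; exact: LpZ.
  - move=> N t ct; rewrite cut0// sub0r big1 ?oppr0// => i _.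
    by rewrite /u cut0// mulr0.
  - rewrite (_ : (fun N => _) = (fun N =>
        lpcnorm p (fun t => b y t - \sum_(i < N) a i y * ys i t))); first exact: bE.
    apply/funext => N; rewrite (lpcnormE p1); congr lpnorm; apply/funext => t.
    rewrite /u /cutc; case: asboolP => // _.
    by rewrite big1 ?subrr// => i _; rewrite mulr0.
  - apply: filterS aeB => t Bt.
    have Iw i : Cintegrable mu (fun s => v i s * y s).
      apply: (@le_Cintegrable _ _ _ mu _ (fun s => (cabs (v i s) * cabs (y s))%:E)).
      + exact: cmeasurableM.
      + by apply/measurable_EFinP; apply: measurable_funM; exact: cmeasurable_cabs.
      + exact: le_lt_trans (alpha_le i) (ltry _).
      + by move=> s; rewrite lee_fin cabsM.
    have aE i : a i y = Cint mu (fun s => v i s * y s).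
      by have [_ _ /(_ y Lcy)[]] := vP i.
    rewrite (_ : (fun N => _) = (fun N => Cint mu (fun s => \sum_(i < N) u i t * (v i s * y s)))).
      have [||||||//] := @Cint_dct _ _ _ mu
        (fun N s => \sum_(i < N) u i t * (v i s * y s)) (fun s => n (t, s) * y s) (K t).
      + by move=> N; apply: cmeasurable_sum => i; apply: cmeasurableZ; exact: cmeasurableM.
      + by apply: cmeasurableM => //; exact: (cmeasurable_comp mn (measurable_pair1 _)).
      + have Koo : (\int[mu]_s K t s < +oo)%E by rewrite BE.
        apply: filterS (ae_lty (mK t) (K0 t) Koo) => s Ks.
        rewrite (_ : (fun N => _) = (fun N => y s * (\sum_(i < N) w i (t, s)))); last first.
          apply/funext => N; rewrite mulr_sumr; apply: eq_bigr => i _.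
          by rewrite /w /= mulrA mulrC.
        (* Finiteness of [K t s] gives convergence of the kernel series only where y(s) is nonzero;
           where y(s) = 0 both sides vanish whatever the series does. *)
        rewrite mulrC; have [y0|yn0] := eqVneq (cabs (y s)) 0.
          rewrite (cabs_eq0 y0) mul0r; under eq_fun do rewrite mul0r.
          exact: ccvg_cst.
        apply: ccvgZ; apply: ccvg_csum.
        move: Ks; rewrite /K /k; under eq_eseriesr do rewrite mulrC EFinM.
        rewrite nneseriesZl; last by move=> i _; rewrite lee_fin cabs_ge0.
        set z := (\sum_(0 <= i <oo) _)%E; case: (ltP z +oo%E) => //.
        rewrite leye_eq => /eqP ->.
        by rewrite gt0_muley// lte_fin lt0r yn0 cabs_ge0.
      + exact: mK.
      + by rewrite BE.
      + move=> N s.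
        apply: le_trans (cabs_partial_sum_le (fun i => u i t * (v i s * y s)) N) _.
        apply: lee_nneseries => [i _ _|i _]; first by rewrite lee_fin cabs_ge0.
        by rewrite /k /w lee_fin !cabsM mulrA.
    apply/funext => N; rewrite Cint_sum; last by move=> i; exact: CintegrableZ.
    by apply: eq_bigr => i _; rewrite CintZ// mulrC aE.
by apply: filterS => t <- ct; rewrite cutE.
Qed.

End nuclear_kernel.

(** * Integer translates of the cube *)

Section lattice.
Context (R : realType) (c : nat).
Local Notation T := (c.-tuple R).
Local Notation mu := (lebn R c).
Implicit Types (t : T) (k m : 'rV[int]_c).

Lemma tnth_shiftv t k i : tnth (shiftv t k) i = tnth t i + (k ord0 i)%:~R.
Proof. by rewrite /shiftv tnth_mktuple. Qed.

Lemma shiftvD t j k : shiftv (shiftv t j) k = shiftv t (j + k).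
Proof.
by apply: eq_from_tnth => i; rewrite !tnth_shiftv mxE intrD addrA.
Qed.

Lemma shiftv0 t : shiftv t 0 = t.
Proof. by apply: eq_from_tnth => i; rewrite tnth_shiftv mxE addr0. Qed.

Lemma shiftvK k : cancel (fun t => shiftv t k) (fun t => shiftv t (- k)).
Proof. by move=> t; rewrite shiftvD addrN shiftv0. Qed.

Lemma shiftvNK k : cancel (fun t => shiftv t (- k)) (fun t => shiftv t k).
Proof. by move=> t; rewrite shiftvD addNr shiftv0. Qed.

(** The index k of the cell k + [0,1)^c that contains t. *)
Definition floorv t : 'rV[int]_c := \row_i Num.floor (tnth t i).

Lemma floorvP t k : floorv t = k <-> cube (shiftv t (- k)).
Proof.
split=> [<- i|ct].
  rewrite tnth_shiftv !mxE mulrNz subr_ge0 ltrBlDr.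
  by have := floor_itv (tnth t i); rewrite intrD addrC.
apply/rowP => i; rewrite mxE; apply: floor_def.
have := ct i; rewrite tnth_shiftv mxE mulrNz subr_ge0 ltrBlDr intrD.
by rewrite [X in _ < X]addrC.
Qed.

Lemma floorv_shiftv t k : cube t -> floorv (shiftv t k) = k.
Proof. by move=> ct; apply/floorvP; rewrite shiftvK. Qed.

Lemma cube_floorv t : cube (shiftv t (- floorv t)).
Proof. exact/floorvP. Qed.

Lemma measurable_floorv k : measurable (floorv @^-1` [set k]).
Proof.
rewrite (_ : _ @^-1` _ = (fun t => shiftv t (- k)) @^-1` @cube R c).
  rewrite -[X in measurable X]setTI; apply: measurable_shiftv => //.
  exact: measurable_cube.
by apply/seteqP; split => t /floorvP.
Qed.

Lemma boxpt_inj N : injective (@boxpt c N).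
Proof.
move=> f g /rowP fg; apply/ffunP => i; apply: val_inj => /=.
have := fg i; rewrite !mxE => /addIr [].
by case.
Qed.

Lemma boxpt_cover m : exists N0, forall N, (N0 <= N)%N ->
  exists f : {ffun 'I_c -> 'I_(N + N).+1}, boxpt f = m.
Proof.
exists (\max_i `|m ord0 i|)%N => N N0N.
have mi i : (`|m ord0 i| <= N)%N.
  by rewrite (leq_trans _ N0N)//; exact: (leq_bigmax_cond (F := fun i => `|m ord0 i|%N)).
exists [ffun i => inord `|(m ord0 i + N%:Z)%R|%N].
apply/rowP => i; rewrite mxE ffunE [RHS](_ : _ = m ord0 i)// inordK.
  by have := mi i; lia.
by have := mi i; lia.
Qed.

(** Meant for sums over cells evaluated at one point s: only the cell containing s contributes, as
    soon as the box reaches it. *)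
Lemma sum_boxpt (V : nmodType) N (G : 'rV[int]_c -> V) m0 :
  (forall m, m != m0 -> G m = 0) ->
  (\sum_(f : {ffun 'I_c -> 'I_(N + N).+1}) G (boxpt f) =
    if [exists f : {ffun 'I_c -> 'I_(N + N).+1}, boxpt f == m0] then G m0 else 0)%R.
Proof.
move=> G0; case: existsP => [[f0 /eqP f0E]|nex].
  rewrite (bigD1 f0)//= f0E big1 ?addr0// => f ff0; apply: G0.
  by rewrite -f0E; apply: contra ff0 => /eqP/boxpt_inj ->.
rewrite big1// => f _; apply: G0; apply/negP => fm; apply: nex; by exists f.
Qed.

Lemma sum_boxpt_esum N (e : 'rV[int]_c -> \bar R) : (forall m, 0 <= e m)%E ->
  (\sum_(f : {ffun 'I_c -> 'I_(N + N).+1}) e (boxpt f) <= \esum_(m in setT) e m)%E.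
Proof.
move=> e0; apply: esum_ge.
pose s := [seq boxpt f | f : {ffun 'I_c -> 'I_(N + N).+1}].
have us : uniq s by rewrite map_inj_uniq ?enum_uniq//; exact: boxpt_inj.
exists [set` s]; first by split => //; exact: finite_seq.
by rewrite -fsbig_seq//= big_map big_enum.
Qed.

(** Distinct lattice points have distinct codes, so the sum is part of a finite geometric sum 1/2 +
    1/4 + ... below 1. These weights are the errors allowed when nuclear representations are
    chosen. *)
Lemma sum_boxpt_geo N :
  \sum_(f : {ffun 'I_c -> 'I_(N + N).+1}) (2^-1 : R) ^+ (pickle (boxpt f)).+1 <= 1.
Proof.
pose s := [seq pickle (boxpt f) | f : {ffun 'I_c -> 'I_(N + N).+1}].
have us : uniq s.
  rewrite map_inj_uniq ?enum_uniq// => f g /(pcan_inj pickleK); exact: boxpt_inj.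
have -> : \sum_(f : {ffun 'I_c -> 'I_(N + N).+1}) (2^-1 : R) ^+ (pickle (boxpt f)).+1 =
    \sum_(i <- s) (2^-1 : R) ^+ i.+1 by rewrite big_map big_enum.
pose M := (\max_(i <- s) i).+1.
have sM i : i \in s -> (i < M)%N by move=> si; rewrite ltnS; exact: leq_bigmax_seq.
have geo n : \sum_(0 <= i < n) (2^-1 : R) ^+ i.+1 = 1 - 2^-1 ^+ n.
  elim: n => [|n IH]; first by rewrite big_geq// expr0 subrr.
  by rewrite big_nat_recr//= IH exprS; lra.
apply: (@le_trans _ _ (\sum_(0 <= i < M) (2^-1 : R) ^+ i.+1)); last first.
  by rewrite geo gerBl exprn_ge0// invr_ge0.
have -> : \sum_(i <- s) (2^-1 : R) ^+ i.+1 =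
    \sum_(i <- [seq i <- index_iota 0 M | i \in s]) (2^-1 : R) ^+ i.+1.
  apply: perm_big; apply: uniq_perm => //; first by rewrite filter_uniq// iota_uniq.
  move=> i; rewrite mem_filter mem_index_iota /=.
  by have [/sM|] := boolP (i \in s).
rewrite big_filter big_mkcond; apply: ler_sum => i _.
by case: ifP => // _; rewrite exprn_ge0// invr_ge0.
Qed.

Lemma lebn_shiftv k (A : set T) : measurable A ->
  lebn R c ((fun t => shiftv t k) @^-1` A) = lebn R c A.
Proof.
move=> mA.
have mS : measurable ((fun t => shiftv t k) @^-1` A).
  by rewrite -[X in measurable X]setTI; exact: measurable_shiftv.
rewrite -!lebint_indic// -[RHS](lebint_shiftv k) //.
exact/measurable_EFinP/measurable_indic.
Qed.

Lemma ae_shiftv k (P : T -> Prop) : {ae mu, forall t, P t} ->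
  {ae mu, forall t, P (shiftv t k)}.
Proof.
move=> [A [mA A0 PA]]; exists ((fun t => shiftv t k) @^-1` A); split.
- by rewrite -[X in measurable X]setTI; exact: measurable_shiftv.
- by have := lebn_shiftv k mA; rewrite A0.
- by move=> t /= nP; exact: PA.
Qed.

Lemma ae_forall_count (I : countType) (P : I -> T -> Prop) :
  (forall i, {ae mu, forall t, P i t}) -> {ae mu, forall t, forall i, P i t}.
Proof.
move=> aeP.
have H : {ae mu, forall t, forall n : nat, if unpickle n is Some i then P i t else True}.
  apply: ae_foralln => n; case: unpickle => [i|]; [exact: aeP|exact: nearW].
by apply: filterS H => t Ht i; have := Ht (pickle i); rewrite pickleK.
Qed.

(** There are countably many cells, so their null sets can be translated back and united. This
    reduces the theorem to one cell k at a time. *)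
Lemma ae_cells (P : T -> Prop) :
  (forall k, {ae mu, forall t, cube t -> P (shiftv t k)}) -> {ae mu, forall t, P t}.
Proof.
move=> aeP.
have H : {ae mu, forall t, forall k, cube (shiftv t (- k)) -> P (shiftv (shiftv t (- k)) k)}.
  by apply: ae_forall_count => k; exact: (ae_shiftv (- k) (aeP k)).
apply: filterS H => t /(_ (floorv t) (cube_floorv t)).
by rewrite shiftvNK.
Qed.

Lemma integral_shiftv_sign k (f : T -> \bar R) : measurable_fun setT f ->
  (\int[mu]_t f (shiftv t k) = \int[mu]_t f t)%E.
Proof.
move=> mf; rewrite integralE [RHS]integralE; congr (_ - _)%E.
- rewrite -[RHS](integral_shiftv k) //.
  + by apply: eq_integral => t _; rewrite !funeposE.
  + exact: measurable_funepos.
- rewrite -[RHS](integral_shiftv k) //.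
  + by apply: eq_integral => t _; rewrite !funenegE.
  + exact: measurable_funeneg.
Qed.

Lemma Cint_shiftv k (f : T -> R[i]) : cmeasurable f ->
  Cint mu (fun t => f (shiftv t k)) = Cint mu f.
Proof.
move=> [m1 m2]; apply: complexP => /=; rewrite /Rintegral; congr fine.
- exact: (@integral_shiftv_sign k (fun t => (complex.Re (f t))%:E) ((measurable_EFinP _ _).2 m1)).
- exact: (@integral_shiftv_sign k (fun t => (complex.Im (f t))%:E) ((measurable_EFinP _ _).2 m2)).
Qed.

Lemma Lp_shiftv (p : R) k (x : T -> R[i]) : Lp p x ->
  Lp p (fun t => x (shiftv t k)) /\ lpnorm p (fun t => x (shiftv t k)) = lpnorm p x.
Proof.
move=> /LpE[mx xoo].
have mxs := cmeasurable_comp mx (measurable_shiftv k).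
have E : Np p (fun t => x (shiftv t k)) = Np p x.
  apply: (@integral_shiftv R c k (fun t => (cabs (x t) `^ p)%:E)).
    exact: measurable_cabs_powR.
  by move=> t; rewrite lee_fin powR_ge0.
split; first by apply/LpE; split; [exact: mxs|rewrite E].
by rewrite (lpnormE p mxs) (lpnormE p mx) E.
Qed.

End lattice.

(** * Gluing countably many kernels along the cells *)

Lemma measurable_glue (R : realType) (d : measure_display) (U : measurableType d)
    (I : countType) (f : U -> I) (F : I -> U -> R) :
  (forall i, measurable (f @^-1` [set i])) ->
  (forall i, measurable_fun setT (F i)) -> measurable_fun setT (fun u => F (f u) u).
Proof.
move=> mf mF _ Y mY.
rewrite (_ : _ `&` _ = \bigcup_i (f @^-1` [set i] `&` (setT `&` F i @^-1` Y))).
  apply: countable_bigcupT_measurable => [|i]; first exact: countableP.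
  by apply: measurableI => //; exact: mF.
apply/seteqP; split => [u [_ Yu]|u [i _ [<- [_ Yu]]]]; last by split.
by exists (f u).
Qed.

Lemma cmeasurable_glue (R : realType) (d : measure_display) (U : measurableType d)
    (I : countType) (f : U -> I) (F : I -> U -> R[i]) :
  (forall i, measurable (f @^-1` [set i])) ->
  (forall i, cmeasurable (F i)) -> cmeasurable (fun u => F (f u) u).
Proof.
move=> mf mF; split.
- exact: (measurable_glue (F := fun i u => complex.Re (F i u)) mf (fun i => (mF i).1)).
- exact: (measurable_glue (F := fun i u => complex.Im (F i u)) mf (fun i => (mF i).2)).
Qed.

Section glued_kernel.
Context (R : realType) (c : nat) (p : R).
Local Notation T := (c.-tuple R).
Local Notation mu := (lebn R c).
Local Notation L := 'rV[int]_c.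

Variable n : L -> L -> T * T -> R[i].
Hypothesis mn : forall k m, cmeasurable (n k m).
Hypothesis n0r : forall k m t s, ~ cube s -> n k m (t, s) = 0.

Definition glued (ts : T * T) : R[i] :=
  n (floorv ts.1) (floorv ts.1 - floorv ts.2)
    (shiftv ts.1 (- floorv ts.1), shiftv ts.2 (- floorv ts.2)).

Lemma cmeasurable_glued : cmeasurable glued.
Proof.
apply: (@cmeasurable_glue _ _ _ (L * L)%type (fun ts : T * T => (floorv ts.1, floorv ts.2))
  (fun kj ts => n kj.1 (kj.1 - kj.2) (shiftv ts.1 (- kj.1), shiftv ts.2 (- kj.2)))).
- move=> [k j].
  rewrite (_ : _ @^-1` _ = (@floorv R c @^-1` [set k]) `*` (@floorv R c @^-1` [set j])).
    by apply: measurableX; exact: measurable_floorv.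
  by apply/seteqP; split => -[t s] /= [-> ->].
- move=> [k j] /=; apply: (cmeasurable_comp (mn k (k - j))).
  apply: measurable_fun_pair.
  + exact: (measurableT_comp (measurable_shiftv (- k)) measurable_fst).
  + exact: (measurableT_comp (measurable_shiftv (- j)) measurable_snd).
Qed.

Variables (x : T -> R[i]) (k : L).
Hypothesis Lx : Lp p x.

Let mx : cmeasurable x. Proof. by case/LpE : Lx. Qed.

(* The part of the kernel over the cells [k] and [k - m], as a function of the
   position [t] in the unit cube and of the point [s] of the whole space. *)
Definition piece m t s := n k m (t, shiftv s (- (k - m))) * x s.

Lemma cmeasurable_pieces m : cmeasurable (fun ts : T * T => piece m ts.1 ts.2).
Proof.
apply: cmeasurableM; last exact: (cmeasurable_comp mx).
apply: (cmeasurable_comp (mn k m)); apply: measurable_fun_pair => //.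
exact: (measurableT_comp (measurable_shiftv _) measurable_snd).
Qed.

Lemma cmeasurable_piece m t : cmeasurable (piece m t).
Proof.
exact: (cmeasurable_comp (cmeasurable_pieces m) (measurable_pair1 t)).
Qed.

(** [piece m t] lives on the cell k - m because the kernels vanish for second argument off the cube.
    At a given s only m = k - [floorv s] survives, so every sum over a box is a single term or 0. *)
Lemma piece_out m t s : m != k - floorv s -> piece m t s = 0.
Proof.
move=> mk; rewrite /piece n0r ?mul0r// => /floorvP fs.
by move: mk; rewrite fs opprB addrCA addrN addr0 eqxx.
Qed.

Lemma piece_in t s : cube t ->
  piece (k - floorv s) t s = glued (shiftv t k, s) * x s.
Proof.
move=> ct; rewrite /piece /glued /= floorv_shiftv// shiftvK.
by congr (n _ _ (_, shiftv s (- _)) * _); rewrite opprB addrCA addrN addr0.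
Qed.

Lemma sum_piece N t s : cube t ->
  \sum_(f : {ffun 'I_c -> 'I_(N + N).+1}) piece (boxpt f) t s =
  if [exists f : {ffun 'I_c -> 'I_(N + N).+1}, boxpt f == k - floorv s]
  then glued (shiftv t k, s) * x s else 0.
Proof.
move=> ct; rewrite -piece_in//.
by apply: (@sum_boxpt _ _ N (fun m => piece m t s)) => m; exact: piece_out.
Qed.

Lemma integral_cabs_piece m t :
  (\int[mu]_s (cabs (piece m t s))%:E =
   \int[mu]_s (cabs (n k m (t, s)) * cabs (x (shiftv s (k - m))))%:E)%E.
Proof.
rewrite -(integral_shiftv (k - m)).
- by apply: eq_integral => s _; rewrite /piece shiftvK cabsM.
- by apply: measurable_ecabs; exact: cmeasurable_piece.
- by move=> s; rewrite lee_fin cabs_ge0.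
Qed.

Lemma Cint_piece m t :
  Cint mu (piece m t) = Cint mu (fun s => n k m (t, s) * x (shiftv s (k - m))).
Proof.
rewrite -(Cint_shiftv (k - m)); last exact: cmeasurable_piece.
by apply: eq_Cint => s; rewrite /piece shiftvK.
Qed.

Variable gam : L -> R.
Variable C : R.
Hypothesis gamC : forall N,
  \sum_(f : {ffun 'I_c -> 'I_(N + N).+1}) gam (boxpt f) <= C.
Hypothesis nbound : forall m,
  (\int[mu]_t \int[mu]_s (cabs (n k m (t, s)) * cabs (x (shiftv s (k - m))))%:E <=
     (gam m)%:E)%E.

Let mglued : cmeasurable (fun ts : T * T => glued (shiftv ts.1 k, ts.2) * x ts.2).
Proof.
apply: cmeasurableM; last exact: (cmeasurable_comp mx).
apply: (cmeasurable_comp cmeasurable_glued); apply: measurable_fun_pair => //.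
exact: (measurableT_comp (measurable_shiftv _) measurable_fst).
Qed.

Let mglued1 t : cmeasurable (fun s => glued (shiftv t k, s) * x s).
Proof. exact: (cmeasurable_comp mglued (measurable_pair1 t)). Qed.

(** The double integral of |glued||x| over the cube in t and the whole space in s is at most [C].
    Fatou in s compares the inner integral with box sums of pieces, Fatou in t does the same for the
    outer one, and [nbound] with [gamC] bounds all box sums uniformly. A finite integral forces a
    finite integrand almost everywhere. *)
Lemma glued_integrable :
  {ae mu, forall t, cube t -> Cintegrable mu (fun s => glued (shiftv t k, s) * x s)}.
Proof.
pose F t := (\int[mu]_s (cabs (glued (shiftv t k, s) * x s))%:E)%E.
(* The indicator is there because the pieces reproduce the glued kernel at [shiftv t k] only for t
   in the cube. *)
pose G t := (F t * (\1_(@cube R c) t)%:E)%E.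
have F0 t : (0 <= F t)%E by apply: integral_ge0 => s _; rewrite lee_fin cabs_ge0.
have mF : measurable_fun setT F.
  apply: (@measurable_fun_fubini_tonelli_F _ _ _ _ _ mu
      (fun ts : T * T => (cabs (glued (shiftv ts.1 k, ts.2) * x ts.2))%:E)).
    exact: measurable_ecabs.
  by move=> ts; rewrite lee_fin cabs_ge0.
have mG : measurable_fun setT G.
  apply: emeasurable_funM => //; apply/measurable_EFinP.
  by apply: measurable_indic; exact: measurable_cube.
have G0 t : (0 <= G t)%E by rewrite mule_ge0.
pose H m t := (\int[mu]_s (cabs (piece m t s))%:E)%E.
have H0 m t : (0 <= H m t)%E by apply: integral_ge0 => s _; rewrite lee_fin cabs_ge0.
have mH m : measurable_fun setT (H m).
  apply: (@measurable_fun_fubini_tonelli_F _ _ _ _ _ mu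
      (fun ts : T * T => (cabs (piece m ts.1 ts.2))%:E)).
    by apply: measurable_ecabs; exact: cmeasurable_pieces.
  by move=> ts; rewrite lee_fin cabs_ge0.
have GC : (\int[mu]_t G t <= C%:E)%E.
  apply: (@fatou_le _ _ _ mu
    (fun N t => (\sum_(f : {ffun 'I_c -> 'I_(N + N).+1}) H (boxpt f) t)%E)) => //.
  - by move=> N; apply: emeasurable_sum => f; exact: mH.
  - by move=> N t; apply: sume_ge0 => f _; exact: H0.
  - move=> t; rewrite /G indicE; have [ct|ct] := pselect (cube t); last first.
      rewrite memNset// mule0 limn_einf_lim; apply: lime_ge; first exact: is_cvg_einfs.
      apply: nearW => N; apply: le_ereal_inf_tmp => _ [M _ <-].
      by apply: sume_ge0 => f _; exact: H0.
    rewrite mem_set// mule1.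
    pose q N s := (\sum_(f : {ffun 'I_c -> 'I_(N + N).+1}) (cabs (piece (boxpt f) t s))%:E)%E.
    have mp m : measurable_fun setT (fun s => (cabs (piece m t s))%:E).
      by apply: measurable_ecabs; exact: cmeasurable_piece.
    have p0 m s : (0 <= (cabs (piece m t s))%:E)%E by rewrite lee_fin cabs_ge0.
    have -> : (fun N => \sum_(f : {ffun 'I_c -> 'I_(N + N).+1}) H (boxpt f) t)%E =
        (fun N => \int[mu]_s q N s)%E.
      by apply/funext => N; rewrite ge0_integral_sum.
    (* Once the box contains k - [floorv s] the sum is this single term, so the sequence is
       eventually constant. *)
    have qE s : limn_einf (q ^~ s) = (cabs (glued (shiftv t k, s) * x s))%:E.
      apply: (cvg_limn_einf_sup _).1.
      have [N0 N0P] := boxpt_cover (k - floorv s).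
      rewrite (_ : q ^~ s = EFin \o (fun N =>
        \sum_(f : {ffun 'I_c -> 'I_(N + N).+1}) cabs (piece (boxpt f) t s))); last first.
        by apply/funext => N; rewrite /q /= sumEFin.
      apply: cvg_EFin; first exact: nearW.
      apply: (@cvg_eventually _ _ _ N0) => N /N0P[f fE].
      rewrite /= (@sum_boxpt _ _ N (fun m => cabs (piece m t s)) (k - floorv s)).
        case: existsP => [_|[]]; first by rewrite piece_in.
        by exists f; rewrite fE.
      by move=> m mk; rewrite piece_out// cabs0.
    rewrite (_ : F t = \int[mu]_s limn_einf (q ^~ s))%E.
      apply: fatou => //.
      + by move=> N; apply: emeasurable_sum => f; exact: mp.
      + by move=> N s _; apply: sume_ge0 => f _; exact: p0.
    by apply: eq_integral => s _; rewrite qE.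
  - move=> N; rewrite ge0_integral_sum//.
    apply: (@le_trans _ _ (\sum_(f : {ffun 'I_c -> 'I_(N + N).+1}) (gam (boxpt f))%:E)%E).
      apply: lee_sum => f _; apply: le_trans (nbound _).
      by under eq_integral do rewrite /H integral_cabs_piece.
    by rewrite sumEFin lee_fin.
have Goo : (\int[mu]_t G t < +oo)%E by exact: le_lt_trans GC (ltry _).
apply: filterS (ae_lty mG G0 Goo) => t + ct; rewrite /G indicE mem_set// mule1.
by split.
Qed.

(** At each s a box sum of pieces is either the full integrand or 0, so the modulus of the integrand
    is itself the dominating function. *)
Lemma glued_box_cvg t : cube t ->
  Cintegrable mu (fun s => glued (shiftv t k, s) * x s) ->
  ccvg (fun N => \sum_(f : {ffun 'I_c -> 'I_(N + N).+1})
          Cint mu (fun s => n k (boxpt f) (t, s) * x (shiftv s (k - boxpt f))))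
       (Cint mu (fun s => glued (shiftv t k, s) * x s)).
Proof.
move=> ct It.
have Ip m : Cintegrable mu (piece m t).
  apply: (@le_Cintegrable _ _ _ mu _ (fun s => (cabs (glued (shiftv t k, s) * x s))%:E)).
  - exact: cmeasurable_piece.
  - exact: measurable_ecabs.
  - exact: It.2.
  - move=> s; rewrite lee_fin; have [->|mk] := eqVneq m (k - floorv s).
      by rewrite piece_in.
    by rewrite piece_out// cabs0 cabs_ge0.
rewrite (_ : (fun N => _) = (fun N => Cint mu
    (fun s => \sum_(f : {ffun 'I_c -> 'I_(N + N).+1}) piece (boxpt f) t s))); last first.
  by apply/funext => N; rewrite Cint_sum//; apply: eq_bigr => f _; rewrite Cint_piece.
have [||||||//] := @Cint_dct _ _ _ mu
  (fun N s => \sum_(f : {ffun 'I_c -> 'I_(N + N).+1}) piece (boxpt f) t s)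
  (fun s => glued (shiftv t k, s) * x s)
  (fun s => (cabs (glued (shiftv t k, s) * x s))%:E).
- by move=> N; apply: cmeasurable_sum => f; exact: cmeasurable_piece.
- exact: mglued1.
- apply: nearW => s; have [N0 N0P] := boxpt_cover (k - floorv s).
  apply: (@cvg_eventually _ _ _ N0) => N /N0P[f fE].
  rewrite sum_piece//; case: existsP => [_|[]]; first by rewrite subrr cabs0.
  by exists f; rewrite fE.
- exact: measurable_ecabs.
- exact: It.2.
- move=> N s; rewrite sum_piece//; case: ifP => // _.
  by rewrite cabs0 lee_fin cabs_ge0.
Qed.

End glued_kernel.

(** * The glued kernel represents the operator *)

Theorem mainTheorem3 (R : realType) (p : R) (c : nat)
    (g : 'rV[int]_c -> R)
    (A : (c.-tuple R -> R[i]) -> (c.-tuple R -> R[i])) :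
  1 <= p -> weight g -> S1g p g A ->
  exists nk : c.-tuple R * c.-tuple R -> R[i],
    measurable_fun setT (fun ts => complex.Re (nk ts)) /\
    measurable_fun setT (fun ts => complex.Im (nk ts)) /\
    forall x, Lp p x ->
      ae (fun t => cintegrable (fun s => nk (t, s) * x s) /\
                   A x t = cint (fun s => nk (t, s) * x s)).
Proof.
move=> p1 [_ [_ _ _ g1 _]] [[AL _ _ _] [b [beta [beta0 betaoo bnuc AE]]]].
set mu := lebn R c.
(* The infimum defining the nuclear norm need not be attained. A representation of cost below
   [beta m + eps m] exists, and the [eps m] add at most 1 to any box sum. *)
pose eps (m : 'rV[int]_c) : R := 2^-1 ^+ (pickle m).+1.
have eps0 m : 0 < eps m by rewrite exprn_gt0// invr_gt0.
pose gam m := beta m + eps m.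
(* As g >= 1, this finite weighted sum bounds every box sum of [beta]. *)
pose E : R := fine (\esum_(m in setT) (g m * `|beta m|)%:E)%E.
have gamC N : \sum_(f : {ffun 'I_c -> 'I_(N + N).+1}) gam (boxpt f) <= E + 1.
  rewrite big_split /= lerD//; last exact: sum_boxpt_geo.
  have e0 m : (0 <= (g m * `|beta m|)%:E)%E.
    by rewrite lee_fin mulr_ge0// (le_trans ler01).
  rewrite -lee_fin /E fineK; last by rewrite ge0_fin_numE// esum_ge0.
  apply: le_trans (sum_boxpt_esum N e0); rewrite -sumEFin; apply: lee_sum => f _.
  by rewrite lee_fin ger0_norm// ler_peMl.
(* One kernel per pair (k, m) is selected before any x is given, so the final kernel serves all x at
   once. *)
have /choice[nn nnP] : forall km : 'rV[int]_c * 'rV[int]_c, exists n : c.-tuple R * c.-tuple R -> R[i],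
  [/\ cmeasurable n, forall t s, ~ cube s -> n (t, s) = 0 &
   forall y, Lp p y ->
    (\int[mu]_t \int[mu]_s (cabs (n (t, s)) * cabs (y s))%:E <=
      (2 * lpnorm p y * gam km.2)%:E)%E /\
    {ae mu, forall t, cube t -> b km.1 km.2 y t = Cint mu (fun s => n (t, s) * y s)}].
  move=> [k m] /=; have [_ nb] := bnuc k m.
  have [] : exists2 s, [set s : \bar R | exists a ys, nuclear_rep p (b k m) a ys /\
    s = (\sum_(0 <= i <oo) (dualnorm p (a i) * (lpcnorm p (ys i))%:E))%E] s & (s < (gam m)%:E)%E.
    by apply: ereal_inf_lt; apply: (le_lt_trans nb); rewrite lte_fin ltrDl.
  move=> _ [a [ys [rep ->]]] sgam.
  have [n [mn n0r nP]] := nuclear_kernel p1 rep.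
  exists n; split => // y Ly; have [n1 n2] := nP y Ly; split => //.
  apply: le_trans n1 _; rewrite [leRHS]EFinM; apply: lee_wpmul2l; last exact: ltW.
  by rewrite lee_fin mulr_ge0// lpnorm_ge0.
pose n k m := nn (k, m).
have mn k m : cmeasurable (n k m) by case: (nnP (k, m)).
have n0r k m t s : ~ cube s -> n k m (t, s) = 0 by case: (nnP (k, m)) => _ + _; exact.
have nP k m := let: And3 _ _ H := nnP (k, m) in H.
have [mg1 mg2] := cmeasurable_glued mn.
exists (glued n); split => //; split => // x Lx; have [mx _] := (LpE _ _).1 Lx.
apply/aeE.
suff : {ae mu, forall t, Cintegrable mu (fun s => glued n (t, s) * x s) /\
    A x t = Cint mu (fun s => glued n (t, s) * x s)}.
  by apply: filterS => t [It ->]; split; [exact/cintegrableE|rewrite cintE].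
apply: ae_cells => k.
(* On the cube this is the component k - m of x. Kept on the whole space it has exactly the norm of
   x, which makes the bounds below depend on m only through [gam m]. *)
pose y m : c.-tuple R -> R[i] := fun s => x (shiftv s (k - m)).
have Ly m : Lp p (y m) by case: (Lp_shiftv (k - m) Lx).
have Ny m : lpnorm p (y m) = lpnorm p x by case: (Lp_shiftv (k - m) Lx).
have aeI : {ae mu, forall t, cube t ->
    Cintegrable mu (fun s => glued n (shiftv t k, s) * x s)}.
  apply: (@glued_integrable _ _ p _ mn n0r x k Lx (fun m => 2 * lpnorm p x * gam m)
    (2 * lpnorm p x * (E + 1))).
  - by move=> N; rewrite -mulr_sumr ler_wpM2l// mulr_ge0// lpnorm_ge0.
  - by move=> m; have [+ _] := nP k m _ (Ly m); rewrite Ny.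
have aeb : {ae mu, forall t m, cube t ->
    b k m (y m) t = Cint mu (fun s => n k m (t, s) * y m s)}.
  by apply: ae_forall_count => m; have [_] := nP k m _ (Ly m).
(* Both sides are cut to the cube because the series over boxes is assumed to converge only in L_p
   of the cube. *)
have aeA : {ae mu, forall t, cutc (fun t => A x (shiftv t k)) t =
    cutc (fun t => Cint mu (fun s => glued n (shiftv t k, s) * x s)) t}.
  have LA : Lp p (fun t => A x (shiftv t k)) by case: (Lp_shiftv k (AL _ Lx)).
  pose S N := fun t => \sum_(f : {ffun 'I_c -> 'I_(N + N).+1}) b k (boxpt f) (y (boxpt f)) t.
  have cutS N : cutc (S N) = (fun t => \sum_(f : {ffun 'I_c -> 'I_(N + N).+1})
      cutc (b k (boxpt f) (y (boxpt f))) t).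
    by apply/funext => t; rewrite /cutc; case: asboolP => // _; rewrite big1.
  apply: (@Lp_ae_lim _ _ _ p1 _ _ (fun N => cutc (S N))).
  - move=> N; apply: LpB => //; first by apply/LpcE => //; exact: Lpc_Lp.
    rewrite cutS; apply: Lp_sum => // f; apply/LpcE => //.
    have [[a [ys [_ _ _ Lb _]]] _] := bnuc k (boxpt f).
    by apply: Lb; exact: Lpc_Lp.
  - by move=> N t ct; rewrite !cut0// subr0.
  - rewrite (_ : (fun N => _) = (fun N => lpcnorm p (fun t => A x (shiftv t k) - S N t))).
      exact: AE.
    by apply/funext => N; rewrite (lpcnormE p1) cutB.
  - apply: filterS2 aeI aeb => t It bt; have [ct|ct] := pselect (cube t); last first.
      by under eq_fun do rewrite cut0//; rewrite cut0//; exact: ccvg_cst.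
    rewrite cutE// (_ : (fun N => _) = (fun N => \sum_(f : {ffun 'I_c -> 'I_(N + N).+1})
        Cint mu (fun s => n k (boxpt f) (t, s) * x (shiftv s (k - boxpt f))))).
      exact: (glued_box_cvg mn n0r Lx ct (It ct)).
    by apply/funext => N; rewrite cutE//; apply: eq_bigr => f _; rewrite bt.
apply: filterS2 aeI aeA => t It + ct; rewrite !cutE// => At.
by split => //; exact: It.
Qed.
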